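(* Let $\mathbf{k}$ be a field, let $Q$ be the quiver with vertex set $\{1,2,3\}$ and exactly four arrows $1\to 2$, $2\to 1$, $2\to 3$, $3\to 2$, and let $A=\mathbf{k}Q/J^2$, where $J$ is the ideal of the path algebra $\mathbf{k}Q$ generated by the arrows. Then the (connected, finite-dimensional) algebra $A$ has a $2$-cluster tilting module, and there exists a simple $A$-module with infinite complexity.
   Context: Algebras are finite-dimensional $\mathbf{k}$-algebras and are assumed connected; modules are finite-dimensional right modules; $\mathrm{mod}\text{-}A$ is the category of finite-dimensional right $A$-modules. For an $A$-module $M$, $\mathrm{add}(M)$ denotes the full subcategory of $\mathrm{mod}\text{-}A$ (closed under isomorphisms) consisting of direct summands of $M^n$ for some $n\ge 1$. An $A$-module $M$ is called a $2$-cluster tilting module if $$\mathrm{add}(M)=\{X\in \mathrm{mod}\text{-}A \mid \mathrm{Ext}_A^1(M,X)=0\}=\{X\in \mathrm{mod}\text{-}A \mid \mathrm{Ext}_A^1(X,M)=0\}.$$ For an $A$-module $N$ with minimal projective resolution $\cdots\to P_n\to P_{n-1}\to\cdots\to P_1\to P_0\to N\to 0$, the complexity of $N$ is $$\mathrm{cx}(N)=\inf\{b\in\mathbb{N}_0 \mid \exists\, c>0:\ \dim_{\mathbf{k}} P_n\le c\,n^{b-1}\ \text{for all } n\ge 1\},$$ where $\mathbb{N}_0=\{0,1,2,\dots\}$. The complexity of $N$ is infinite if no such $b\in\mathbb{N}_0$ exists. *)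

(* Defs.v *)
From HB Require Import structures.
From mathcomp Require Import all_boot all_order all_algebra.
From mathcomp Require Import finmap.
From mathcomp Require Import boolp reals.
From mathcomp.multinomials Require Import monalg.

Set Implicit Arguments.
Unset Strict Implicit.
Unset Printing Implicit Defensive.

Import GRing.Theory Num.Theory.
Local Open Scope ring_scope.

(** * Quivers and path algebras *)

(* A quiver has at least one vertex, so that its path algebra is a nonzero
   ring, as required by [algType]. *)
Record quiver := Quiver {
  vertex : finType;
  arrow : finType;
  source : arrow -> vertex;
  target : arrow -> vertex;
  base_vertex : vertex }.

Section Path.
Variable Q : quiver.

Fixpoint walk (v : vertex Q) (s : seq (arrow Q)) : bool :=
  if s is a :: s' then (source a == v) && walk (target a) s' else true.

(* A path is its starting vertex together with its sequence of arrows, read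
   from left to right; [(v, [::])] is the trivial path at [v]. *)
Definition qpath := {p : vertex Q * seq (arrow Q) | walk p.1 p.2}.

Definition pstart (p : qpath) : vertex Q := (val p).1.
Definition parrows (p : qpath) : seq (arrow Q) := (val p).2.
Definition pend (p : qpath) : vertex Q :=
  last (pstart p) (map (@target Q) (parrows p)).

Definition trivial_path (v : vertex Q) : qpath := Sub (v, [::]) isT.

Lemma walk1 (a : arrow Q) : walk (source a) [:: a].
Proof. by rewrite /= eqxx. Qed.

Definition arrow_path (a : arrow Q) : qpath := Sub (source a, [:: a]) (walk1 a).

Lemma walk_cat v s t :
  walk v (s ++ t) = walk v s && walk (last v (map (@target Q) s)) t.
Proof. by elim: s v => [|a s IHs] v //=; rewrite IHs andbA. Qed.

Lemma walk_pcat (p q : qpath) : pend p = pstart q ->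
  walk (pstart p) (parrows p ++ parrows q).
Proof. by move=> e; rewrite walk_cat (valP p) /= -/(pend p) e (valP q). Qed.

(* The concatenation "first [p], then [q]". *)
Definition pcat (p q : qpath) (e : pend p = pstart q) : qpath :=
  Sub (pstart p, parrows p ++ parrows q) (walk_pcat e).

Lemma pend_pcat p q e : pend (@pcat p q e) = pend q.
Proof. by rewrite /pend /parrows /pstart /= map_cat last_cat -/(pend p) e. Qed.

End Path.

Section PathAlgebra.
Variables (k : fieldType) (Q : quiver).

Definition path_algebra := {malg k[qpath Q]}.
HB.instance Definition _ := GRing.Lmodule.on path_algebra.

End PathAlgebra.

(* Locked, as unification may diverge when it unfolds [<< p >>]. *)
HB.lock Definition pbasis (k : fieldType) (Q : quiver) (p : qpath Q) :
  path_algebra k Q := << p >>.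

Section PathAlgebraRing.
Variables (k : fieldType) (Q : quiver).
Local Notation path_algebra := (path_algebra k Q).
Local Notation pbasis := (@pbasis k Q).

Definition linext (V : lmodType k) (h : qpath Q -> V) (f : path_algebra) : V :=
  \sum_(p <- msupp f) f@_p *: h p.

Definition pmul_basis (p q : qpath Q) : path_algebra :=
  if pend p =P pstart q is ReflectT e then pbasis (pcat e) else 0.

Definition pmul (f g : path_algebra) : path_algebra :=
  linext (fun p => linext (pmul_basis p) g) f.

Definition pone : path_algebra := \sum_v pbasis (trivial_path v).

Lemma linextw (V : lmodType k) (h : qpath Q -> V) (d : {fset qpath Q})
    (f : path_algebra) :
  (msupp f `<=` d)%fset -> linext h f = \sum_(p <- d) f@_p *: h p.
Proof.
move=> sfd; rewrite /linext (big_fset_incl _ sfd) //= => p _ /mcoeff_outdom ->.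
by rewrite scale0r.
Qed.

Lemma linext_is_linear (V : lmodType k) (h : qpath Q -> V) : linear (@linext V h).
Proof.
move=> c f g; pose d := (msupp (c *: f + g) `|` msupp f `|` msupp g)%fset.
rewrite !(@linextw V h d); first last.
- by rewrite /d -fsetUA fsubsetUl.
- by rewrite /d -fsetUA fsubsetU // fsubsetUl orbT.
- by rewrite /d fsubsetUr.
rewrite scaler_sumr -big_split /=; apply: eq_bigr => p _.
by rewrite mcoeffD mcoeffZ scalerDl scalerA.
Qed.

HB.instance Definition _ (V : lmodType k) (h : qpath Q -> V) :=
  GRing.isLinear.Build k path_algebra V _ (@linext V h) (@linext_is_linear V h).

Lemma linextU (V : lmodType k) (h : qpath Q -> V) p : linext h (pbasis p) = h p.
Proof.
rewrite /linext ?pbasis.unlock msuppU oner_eq0 big_seq_fset1.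
by rewrite mcoeffU eqxx scale1r.
Qed.

Lemma pbasisE (f : path_algebra) : f = linext pbasis f.
Proof.
rewrite {1}[f]monalgE /linext ?pbasis.unlock; apply: eq_bigr => p _.
by apply/malgP => q; rewrite mcoeffU [RHS]mcoeffZ mcoeffU mulr_natr.
Qed.

Lemma pbasis_ind (V : lmodType k) (F G : {linear path_algebra -> V}) :
  (forall p, F (pbasis p) = G (pbasis p)) -> F =1 G.
Proof.
move=> e f; rewrite [f]pbasisE /linext !linear_sum.
by apply: eq_bigr => p _; rewrite !linearZ /= e.
Qed.

Lemma pmul_is_linear_r f : linear (pmul f).
Proof.
move=> c g h; rewrite /pmul /linext scaler_sumr -big_split /=.
apply: eq_bigr => p _; rewrite -!/(linext _ _) linearP scalerDr !scalerA.
by rewrite mulrC.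
Qed.

HB.instance Definition _ f :=
  GRing.isLinear.Build k path_algebra path_algebra _ (pmul f)
    (pmul_is_linear_r f).

Definition pmulr (g f : path_algebra) := pmul f g.

Lemma pmul_is_linear_l g : linear (pmulr g).
Proof. by move=> c f h; rewrite /pmulr /pmul linearP. Qed.

HB.instance Definition _ g :=
  GRing.isLinear.Build k path_algebra path_algebra _ (pmulr g)
    (pmul_is_linear_l g).

Lemma pmulUU p q : pmul (pbasis p) (pbasis q) = pmul_basis p q.
Proof. by rewrite /pmul !linextU. Qed.

Lemma pmul_basis0 p q : pend p <> pstart q -> pmul_basis p q = 0.
Proof. by move=> n; rewrite /pmul_basis; case: eqP => [/n []|_]. Qed.

Lemma pmul_basisE p q (e : pend p = pstart q) :
  pmul_basis p q = pbasis (pcat e).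
Proof.
rewrite /pmul_basis; case: eqP => [e'|/(_ e)[]].
by rewrite (eq_irrelevance e' e).
Qed.

Lemma pmul_basisA p q r :
  pmul (pbasis p) (pmul_basis q r) = pmul (pmul_basis p q) (pbasis r).
Proof.
have [epq|npq] := pselect (pend p = pstart q); last first.
  rewrite (pmul_basis0 npq) -/(pmulr _ 0) linear0.
  have [eqr|/pmul_basis0 ->] := pselect (pend q = pstart r); last first.
    by rewrite linear0.
  by rewrite (pmul_basisE eqr) (pmulUU p (pcat eqr)) pmul_basis0.
rewrite (pmul_basisE epq) [RHS](pmulUU (pcat epq) r).
have [eqr|nqr] := pselect (pend q = pstart r); last first.
  by rewrite (pmul_basis0 nqr) linear0 pmul_basis0 // pend_pcat.
have e1 : pend p = pstart (pcat eqr) by [].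
have e2 : pend (pcat epq) = pstart r by rewrite pend_pcat.
rewrite (pmul_basisE eqr) [LHS](pmulUU p (pcat eqr)).
rewrite (pmul_basisE e1) (pmul_basisE e2); congr pbasis; apply: val_inj.
by rewrite /= /parrows /= catA.
Qed.

Lemma pmulA : associative pmul.
Proof.
move=> f g h.
apply: (pbasis_ind (F := pmulr (pmul g h)) (G := pmulr h \o pmulr g)) => p /=.
rewrite /pmulr.
apply: (pbasis_ind (F := pmul (pbasis p) \o pmulr h)
                   (G := pmulr h \o pmul (pbasis p))) => q /=; rewrite /pmulr.
apply: (pbasis_ind (F := pmul (pbasis p) \o pmul (pbasis q))
                   (G := pmul (pmul (pbasis p) (pbasis q)))) => r /=.
by rewrite !pmulUU pmul_basisA.
Qed.

Lemma pmul1f : left_id pone pmul.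
Proof.
move=> f; apply: (pbasis_ind (F := pmul pone) (G := idfun)) => p /=.
rewrite -/(pmulr _ _) /pone linear_sum (bigD1 (pstart p)) //= big1 => [|v ne].
  rewrite addr0 /pmulr pmulUU (@pmul_basisE (trivial_path (pstart p)) p erefl).
  congr pbasis; apply: val_inj.
  by rewrite /= /pstart /parrows /= -surjective_pairing.
rewrite /pmulr pmulUU pmul_basis0 // => e; move/eqP: ne; apply.
by rewrite -e.
Qed.

Lemma pmulf1 : right_id pone pmul.
Proof.
move=> f; apply: (pbasis_ind (F := pmulr pone) (G := idfun)) => p /=.
rewrite /pmulr /pone linear_sum (bigD1 (pend p)) //= big1 => [|v ne].
  rewrite addr0 pmulUU (@pmul_basisE p (trivial_path (pend p)) erefl).
  congr pbasis; apply: val_inj.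
  by rewrite /= /pstart /parrows cats0 -surjective_pairing.
by rewrite pmulUU pmul_basis0 // => e; move/eqP: ne; apply; rewrite e.
Qed.

Lemma pmulDl : left_distributive pmul +%R.
Proof. by move=> f g h; rewrite -!/(pmulr _ _) linearD. Qed.

Lemma pmulDr : right_distributive pmul +%R.
Proof. by move=> f g h; rewrite linearD. Qed.

Lemma mcoeff_pbasis p q : (pbasis p)@_q = (p == q)%:R.
Proof. by rewrite pbasis.unlock mcoeffU. Qed.

Lemma pone_neq0 : pone != 0.
Proof.
apply/eqP => /(congr1 (mcoeff (trivial_path (base_vertex Q)))) /eqP.
rewrite mcoeff0 raddf_sum (bigD1 (base_vertex Q)) //= big1 => [|v ne].
  by rewrite addr0 mcoeff_pbasis eqxx oner_eq0.
rewrite mcoeff_pbasis; case: eqP => // /(congr1 val) [e].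
by rewrite e eqxx in ne.
Qed.

HB.instance Definition _ := GRing.Zmodule_isNzRing.Build path_algebra
  pmulA pmul1f pmulf1 pmulDl pmulDr pone_neq0.

Lemma pscalerAl (c : k) (f g : path_algebra) : c *: (f * g) = (c *: f) * g.
Proof. by rewrite -[RHS]/(pmulr g (c *: f)) linearZ. Qed.

HB.instance Definition _ :=
  GRing.Lmodule_isLalgebra.Build k path_algebra pscalerAl.

Lemma pscalerAr (c : k) (f g : path_algebra) : c *: (f * g) = f * (c *: g).
Proof. by rewrite -[RHS]/(pmul f (c *: g)) linearZ. Qed.

HB.instance Definition _ :=
  GRing.Lalgebra_isAlgebra.Build k path_algebra pscalerAr.

Lemma pbasisM p q : pbasis p * pbasis q = pmul_basis p q.
Proof. exact: pmulUU. Qed.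

End PathAlgebraRing.

(** * Two-sided ideals and quotient algebras *)

Section Ideals.
Variables (k : fieldType) (R : algType k).
Implicit Types (I J S : R -> Prop).

Definition two_sided_ideal I : Prop :=
  [/\ I 0, forall x y, I x -> I y -> I (x - y)
    & forall a x, I x -> I (a * x) /\ I (x * a)].

Definition ideal_gen S (x : R) : Prop :=
  forall I, two_sided_ideal I -> (forall s, S s -> I s) -> I x.

Definition ideal_mul I J : R -> Prop :=
  ideal_gen (fun z => exists x y, [/\ I x, J y & z = x * y]).

Lemma ideal_gen_ideal S : two_sided_ideal (ideal_gen S).
Proof.
split=> [I [] //|x y Sx Sy I hI hS|a x Sx].
  by case: (hI) => _ hB _; apply: hB; [apply: Sx|apply: Sy].
by split=> I hI hS; case: (hI) => _ _ hM; case: (hM a x (Sx I hI hS)).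
Qed.

Record proper_ideal := ProperIdeal {
  ideal_car : R -> Prop;
  ideal_carP : two_sided_ideal ideal_car;
  ideal_proper : ~ ideal_car 1 }.

End Ideals.

Section QuotientAlgebra.
Variables (k : fieldType) (R : algType k) (I : proper_ideal R).
Local Open Scope quotient_scope.

Definition ideal_pred : pred R := fun x => `[< ideal_car I x >].

Lemma ideal_pred_zmod : zmod_closed ideal_pred.
Proof.
case: (ideal_carP I) => h0 hB _; split; first exact/asboolP.
by move=> x y /asboolP Ix /asboolP Iy; apply/asboolP/hB.
Qed.

HB.instance Definition _ :=
  GRing.isZmodClosed.Build R ideal_pred ideal_pred_zmod.

Definition ideal_zmod : zmodClosed R :=
  GRing.ZmodClosed.clone R ideal_pred _.

Definition quot_algebra := Quotient.quot ideal_zmod.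
HB.instance Definition _ := GRing.Zmodule.on quot_algebra.
HB.instance Definition _ : EqQuotient R (Quotient.equiv ideal_zmod) quot_algebra :=
  EqQuotient.on quot_algebra.

Definition qproj (x : R) : quot_algebra := \pi_quot_algebra x.

Lemma qproj_eq x y : qproj x = qproj y <-> ideal_car I (x - y).
Proof.
rewrite /qproj; split=> [/eqP|h].
  by rewrite -(@Quotient.idealrBE R ideal_zmod) => /asboolP.
by apply/eqP; rewrite -(@Quotient.idealrBE R ideal_zmod); apply/asboolP.
Qed.

Lemma qprojK (u : quot_algebra) : qproj (repr u) = u.
Proof. exact: reprK. Qed.

Lemma qprojD x y : qproj (x + y) = qproj x + qproj y.
Proof. exact: (Quotient.pi_add ideal_zmod). Qed.

Definition qmul (u v : quot_algebra) : quot_algebra := qproj (repr u * repr v).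
Definition qscale (c : k) (u : quot_algebra) : quot_algebra :=
  qproj (c *: repr u).

Lemma ideal_reprB x : ideal_car I (x - repr (qproj x)).
Proof. by apply/qproj_eq; rewrite qprojK. Qed.

Lemma qprojM x y : qproj (x * y) = qmul (qproj x) (qproj y).
Proof.
apply/qproj_eq; case: (ideal_carP I) => h0 hB hM.
set x' := repr _; set y' := repr _.
have -> : x * y - x' * y' = (x - x') * y - (x' * (y' - y)).
  by rewrite mulrBl mulrBr opprB addrA subrK.
apply: (hB); first by case: (hM y _ (ideal_reprB x)).
have := hB _ _ h0 (ideal_reprB y); rewrite sub0r opprB => h.
by case: (hM x' _ h).
Qed.

Lemma qprojZ c x : qproj (c *: x) = qscale c (qproj x).
Proof.
apply/qproj_eq; rewrite -scalerBr -[_ - _]mul1r scalerAl.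
by case: (ideal_carP I) => _ _ hM; case: (hM (c *: 1) _ (ideal_reprB x)).
Qed.

Lemma qmulA : associative qmul.
Proof.
move=> u v w; rewrite -[u]qprojK -[v]qprojK -[w]qprojK -!qprojM.
by rewrite mulrA.
Qed.

Lemma qmul1 : left_id (qproj 1) qmul.
Proof. by move=> u; rewrite -[u]qprojK -qprojM mul1r. Qed.

Lemma qmulr1 : right_id (qproj 1) qmul.
Proof. by move=> u; rewrite -[u]qprojK -qprojM mulr1. Qed.

Lemma qmulDl : left_distributive qmul +%R.
Proof.
move=> u v w; rewrite -[u]qprojK -[v]qprojK -[w]qprojK.
by rewrite -qprojD -!qprojM -qprojD mulrDl.
Qed.

Lemma qmulDr : right_distributive qmul +%R.
Proof.
move=> u v w; rewrite -[u]qprojK -[v]qprojK -[w]qprojK.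
by rewrite -qprojD -!qprojM -qprojD mulrDr.
Qed.

Lemma qproj0 : qproj 0 = 0.
Proof. by apply: (addrI (qproj 0)); rewrite -qprojD !addr0. Qed.

Lemma qone_neq0 : qproj 1 != 0.
Proof.
apply/eqP; rewrite -qproj0 => /qproj_eq; rewrite subr0; exact: ideal_proper.
Qed.

HB.instance Definition _ := GRing.Zmodule_isNzRing.Build quot_algebra
  qmulA qmul1 qmulr1 qmulDl qmulDr qone_neq0.

Lemma qscaleA a b v : qscale a (qscale b v) = qscale (a * b) v.
Proof. by rewrite -[v]qprojK -!qprojZ scalerA. Qed.

Lemma qscale1 : left_id 1 qscale.
Proof. by move=> v; rewrite -[v]qprojK -qprojZ scale1r. Qed.

Lemma qscaleDr : right_distributive qscale +%R.
Proof.
move=> c u v; rewrite -[u]qprojK -[v]qprojK.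
by rewrite -qprojD -!qprojZ -qprojD scalerDr.
Qed.

Lemma qscaleDl v : {morph qscale^~ v : a b / a + b}.
Proof. by move=> a b; rewrite -[v]qprojK -!qprojZ -qprojD scalerDl. Qed.

HB.instance Definition _ := GRing.Zmodule_isLmodule.Build k quot_algebra
  qscaleA qscale1 qscaleDr qscaleDl.

Lemma qscalerAl (c : k) (u v : quot_algebra) : c *: (u * v) = (c *: u) * v.
Proof.
rewrite -[u]qprojK -[v]qprojK -[_ * _]qprojM -[LHS]qprojZ scalerAl.
by rewrite qprojM qprojZ.
Qed.

HB.instance Definition _ :=
  GRing.Lmodule_isLalgebra.Build k quot_algebra qscalerAl.

Lemma qscalerAr (c : k) (u v : quot_algebra) : c *: (u * v) = u * (c *: v).
Proof.
rewrite -[u]qprojK -[v]qprojK -[_ * _]qprojM -[LHS]qprojZ scalerAr.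
by rewrite qprojM qprojZ.
Qed.

HB.instance Definition _ :=
  GRing.Lalgebra_isAlgebra.Build k quot_algebra qscalerAr.

End QuotientAlgebra.

(** * The radical square zero algebra of a quiver *)

Section RadSquareZero.
Variables (k : fieldType) (Q : quiver).
Local Notation kQ := (path_algebra k Q).

Definition arrow_ideal : kQ -> Prop :=
  ideal_gen (fun z => exists a, z = pbasis k (arrow_path a)).

Definition arrow_ideal_sq : kQ -> Prop := ideal_mul arrow_ideal arrow_ideal.

Lemma coef_trivialM (v : vertex Q) (f g : kQ) :
  (f * g)@_(trivial_path v) = f@_(trivial_path v) * g@_(trivial_path v).
Proof.
have lin1 (h : kQ) (p : qpath Q) :
    linear (fun f : kQ => (f * h)@_p : k^o).
  by move=> c x y; rewrite mulrDl mcoeffD -scalerAl mcoeffZ.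
have lin2 (h : kQ) (p : qpath Q) :
    linear (fun f : kQ => (h * f)@_p : k^o).
  by move=> c x y; rewrite mulrDr mcoeffD -scalerAr mcoeffZ.
have lin3 (c : k) (p : qpath Q) : linear (fun f : kQ => f@_p * c : k^o).
  by move=> a x y; rewrite mcoeffD mcoeffZ mulrDl -mulrA.
have lin4 (c : k) (p : qpath Q) : linear (fun f : kQ => c * f@_p : k^o).
  by move=> a x y; rewrite mcoeffD mcoeffZ mulrDr mulrCA.
have F1 h p := GRing.isLinear.Build _ _ _ _ _ (lin1 h p).
have F2 h p := GRing.isLinear.Build _ _ _ _ _ (lin2 h p).
have F3 h p := GRing.isLinear.Build _ _ _ _ _ (lin3 h p).
have F4 h p := GRing.isLinear.Build _ _ _ _ _ (lin4 h p).
pose L1 h p : {linear kQ -> k^o} := HB.pack (fun f : kQ => (f * h)@_p : k^o) (F1 h p).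
pose L2 h p : {linear kQ -> k^o} := HB.pack (fun f : kQ => (h * f)@_p : k^o) (F2 h p).
pose L3 h p : {linear kQ -> k^o} := HB.pack (fun f : kQ => f@_p * h : k^o) (F3 h p).
pose L4 h p : {linear kQ -> k^o} := HB.pack (fun f : kQ => h * f@_p : k^o) (F4 h p).
apply: (pbasis_ind (F := L1 g (trivial_path v))
                   (G := L3 g@_(trivial_path v) (trivial_path v))) => p /=.
apply: (pbasis_ind (F := L2 (pbasis k p) (trivial_path v))
   (G := L4 (pbasis k p)@_(trivial_path v) (trivial_path v))) => q /=.
rewrite pbasisM !mcoeff_pbasis.
have [e|n] := pselect (pend p = pstart q).
  rewrite (pmul_basisE k e) mcoeff_pbasis -natrM mulnb; congr (_%:R).
  congr nat_of_bool.
  case: p q e => [[a s] hp] [[b t] hq] e.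
  rewrite -!val_eqE /= !xpair_eqE /parrows /=.
  case: s hp e => [|x s] hp e /=; last by rewrite !andbF.
  by move: e; rewrite /pend /pstart /= => ->; case: (b == v).
rewrite (pmul_basis0 k n) mcoeff0 -natrM mulnb.
case: eqP => //= ep; case: eqP => //= eq.
by case: n; rewrite ep eq.
Qed.

Lemma arrow_ideal_sq_proper : ~ arrow_ideal_sq 1.
Proof.
pose K (f : kQ) : Prop := f@_(trivial_path (base_vertex Q)) = 0.
have idK : two_sided_ideal K.
  split=> [|x y|a x]; rewrite /K ?mcoeff0 //.
    by move=> ex ey; rewrite mcoeffB ex ey subr0.
  by move=> ex; split; rewrite [LHS]coef_trivialM ex ?mulr0 ?mul0r.
have arK x : arrow_ideal x -> K x.
  apply=> // _ [a ->]; rewrite /K mcoeff_pbasis.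
  by case: eqP => // /(congr1 val).
move/(_ K idK) => h; have {h} : K 1.
  apply: h => _ [x [y [/arK Kx /arK Ky ->]]].
  by rewrite /K coef_trivialM Kx mul0r.
move=> K1; have /eqP[] := oner_neq0 k.
pose v := base_vertex Q; pose e := pbasis k (trivial_path v).
have e1 : e@_(trivial_path v) = 1 by rewrite mcoeff_pbasis eqxx.
by rewrite -e1 -[e]mulr1 [LHS]coef_trivialM K1 mulr0.
Qed.

Definition arrow_ideal_sq_ideal : proper_ideal kQ :=
  ProperIdeal (ideal_gen_ideal _) arrow_ideal_sq_proper.

Definition rad_square_zero : algType k := quot_algebra arrow_ideal_sq_ideal.

End RadSquareZero.

(* Vertices 1, 2, 3 are 0, 1, 2 : 'I_3; the arrows are, in this order,
   1 -> 2, 2 -> 1, 2 -> 3, 3 -> 2. *)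
Definition quiver3 : quiver :=
  @Quiver 'I_3 'I_4
    (tnth [tuple inord 0; inord 1; inord 1; inord 2])
    (tnth [tuple inord 1; inord 0; inord 2; inord 1])
    ord0.

(** * Finite-dimensional algebras and right modules *)

Section Algebra.
Variables (k : fieldType) (A : algType k).

Definition finite_dimensional : Prop :=
  exists n (f : {linear A -> 'rV[k]_n}), bijective f.

(* Members of [algType k] are nonzero rings. *)
Definition connected_algebra : Prop :=
  ~ exists (B C : algType k) (f : {lrmorphism A -> (B * C)%type}), bijective f.

End Algebra.

(* A finite-dimensional right module: [ract a] is the map [x |-> x . a], so
   that [x . (a b) = (x . a) . b]. *)
Record rmod (k : fieldType) (A : algType k) := RMod {
  rcar :> vectType k;
  ract : {linear A -> 'End(rcar)};
  ract1 : ract 1 = \1%VF;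
  ractM : forall a b, ract (a * b) = (ract b \o ract a)%VF }.

Section Modules.
Variables (k : fieldType) (A : algType k).
Implicit Types M N X Y P : rmod A.

Definition is_hom M N (f : 'Hom(M, N)) : Prop :=
  forall a x, f (ract M a x) = ract N a (f x).

Definition isomorphic M N : Prop :=
  exists f : 'Hom(M, N), is_hom f /\ bijective f.

Definition submodule M (U : {vspace M}) : Prop :=
  forall a, (ract M a @: U <= U)%VS.

Definition simple_module M : Prop :=
  (fullv : {vspace M}) <> 0%VS /\
  forall U : {vspace M}, submodule U -> U = 0%VS \/ U = fullv.

Section DirectSum.
Variables M N : rmod A.

Definition dsum_fun (a : A) (x : M * N) : M * N :=
  (ract M a x.1, ract N a x.2).

Lemma dsum_fun_linear a : linear (dsum_fun a).
Proof. by move=> c x y; rewrite /dsum_fun /= !linearP. Qed.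

HB.instance Definition _ a :=
  GRing.isLinear.Build k (M * N)%type (M * N)%type _ (dsum_fun a)
    (dsum_fun_linear a).

Definition dsum_act (a : A) : 'End((M * N)%type) := linfun (dsum_fun a).

Lemma dsum_act_linear : linear dsum_act.
Proof.
move=> c a b; apply/lfunP => x; rewrite !lfunE /= !lfunE /= !lfunE /=.
by rewrite /dsum_fun !linearP /= !add_lfunE !scale_lfunE.
Qed.

HB.instance Definition _ :=
  GRing.isLinear.Build k A 'End((M * N)%type) _ dsum_act dsum_act_linear.

Lemma dsum_act1 : dsum_act 1 = \1%VF.
Proof.
apply/lfunP => -[x y]; rewrite !lfunE /= /dsum_fun /= !ract1.
by rewrite !id_lfunE.
Qed.

Lemma dsum_actM a b : dsum_act (a * b) = (dsum_act b \o dsum_act a)%VF.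
Proof.
apply/lfunP => -[x y]; rewrite comp_lfunE !lfunE /= /dsum_fun /= !ractM.
by rewrite !comp_lfunE.
Qed.

Definition dsum : rmod A := RMod dsum_act1 dsum_actM.

End DirectSum.

Section Power.
Variables (M : rmod A) (n : nat).
Local Notation Mn := {ffun 'I_n -> M}.

Definition dpow_fun (a : A) (x : Mn) : Mn := [ffun i => ract M a (x i)].

Lemma dpow_fun_linear a : linear (dpow_fun a).
Proof. by move=> c x y; apply/ffunP => i; rewrite !ffunE linearP. Qed.

HB.instance Definition _ a :=
  GRing.isLinear.Build k Mn Mn _ (dpow_fun a) (dpow_fun_linear a).

Definition dpow_act (a : A) : 'End(Mn) := linfun (dpow_fun a).

Lemma dpow_act_linear : linear dpow_act.
Proof.
move=> c a b; apply/lfunP => x; rewrite add_lfunE scale_lfunE !lfunE /=.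
by apply/ffunP => i; rewrite !ffunE linearP add_lfunE scale_lfunE.
Qed.

HB.instance Definition _ :=
  GRing.isLinear.Build k A 'End(Mn) _ dpow_act dpow_act_linear.

Lemma dpow_act1 : dpow_act 1 = \1%VF.
Proof.
by apply/lfunP => x; rewrite !lfunE; apply/ffunP => i; rewrite ffunE ract1 id_lfunE.
Qed.

Lemma dpow_actM a b : dpow_act (a * b) = (dpow_act b \o dpow_act a)%VF.
Proof.
apply/lfunP => x; rewrite comp_lfunE !lfunE /=.
by apply/ffunP => i; rewrite !ffunE ractM comp_lfunE.
Qed.

Definition dpow : rmod A := RMod dpow_act1 dpow_actM.

End Power.

Definition in_add M X : Prop :=
  exists n Y, (0 < n)%N /\ isomorphic (dsum X Y) (dpow M n).

Definition projective P : Prop :=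
  forall M N (g : 'Hom(M, N)) (f : 'Hom(P, N)),
    is_hom g -> limg g = fullv -> is_hom f ->
    exists h : 'Hom(P, M), is_hom h /\ (g \o h)%VF = f.

Record proj_resolution M := ProjResolution {
  res_obj :> nat -> rmod A;
  res_diff : forall n, 'Hom(res_obj n.+1, res_obj n);
  res_aug : 'Hom(res_obj 0, M);
  res_diff_hom : forall n, is_hom (res_diff n);
  res_aug_hom : is_hom res_aug;
  res_proj : forall n, projective (res_obj n);
  res_aug_onto : limg res_aug = fullv;
  res_exact0 : limg (res_diff 0) = lker res_aug;
  res_exact : forall n, limg (res_diff n.+1) = lker (res_diff n) }.

(* [Ext^1_A(M, X) = 0]: the first cohomology of the complex [Hom_A(P, X)]
   vanishes, for projective resolutions [P] of [M]. *)
Definition Ext1_zero M X : Prop :=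
  forall (P : proj_resolution M) (f : 'Hom(P 1%N, X)),
    is_hom f -> (f \o res_diff P 1)%VF = 0 ->
    exists g : 'Hom(P 0%N, X), is_hom g /\ f = (g \o res_diff P 0)%VF.

Definition cluster_tilting2 M : Prop :=
  forall X, (in_add M X <-> Ext1_zero M X) /\ (in_add M X <-> Ext1_zero X M).

Definition superfluous M (K : {vspace M}) : Prop :=
  forall U : {vspace M}, submodule U -> (U + K)%VS = fullv -> U = fullv.

(* Minimality: [res_aug] and the corestrictions of the [res_diff n] to their
   images are projective covers. *)
Definition minimal_resolution M (P : proj_resolution M) : Prop :=
  superfluous (lker (res_aug P)) /\
  forall n, superfluous (lker (res_diff P n)).

Definition complexity_bound (R : realType) M (P : proj_resolution M) (b : nat) :
    Prop :=
  exists c : R, 0 < c /\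
    forall n, (1 <= n)%N ->
      (\dim (fullv : {vspace P n}))%:R <= c * n%:R ^ (b%:Z - 1).

(* The minimal projective resolution is unique up to isomorphism, so that any
   choice of it may be used. *)
Definition infinite_complexity (R : realType) M : Prop :=
  exists P : proj_resolution M, minimal_resolution P /\
    forall b : nat, ~ complexity_bound R P b.

End Modules.

(* Main.v *)
Require Import Defs.
From HB Require Import structures.
From mathcomp Require Import all_boot all_order all_algebra.
From mathcomp Require Import boolp reals.
From mathcomp.multinomials Require Import monalg.

(** Write a right module [X] as a representation of the quiver, with maps
    [a : V1 -> V2], [b : V2 -> V1], [c : V2 -> V3], [d : V3 -> V2] all of whose
    composites vanish. The cluster tilting module is
    [M = (P2 (+) P13) (+) (I2 (+) I13)], the sum of the indecomposable projectives
    and injectives ([P13 = P1 (+) P3], [I13 = I1 (+) I3]). From the covers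
    [P13 -> I2] and [P2 (+) P2 -> I13] one reads off that [Ext^1(M, X) = 0] means
      [im b = ker a], [im c = ker d] and [im a + im d = ker b :&: ker c],
    and the embeddings [P2 -> I13] and [P13 -> I2 (+) I2] show that
    [Ext^1(X, M) = 0] means the same. These three equations pass to summands and
    hold for [M]; conversely they allow one to split
    [V2 = V20 (+) V2b (+) V2c (+) Z (+) Za (+) Zd] and to write the identity of
    [X] as a sum of maps factoring through [M].

    The simple module [S2] has the minimal resolution
      [... -> P2^4 -> P13^2 -> P2^2 -> P13 -> P2 -> S2],
    whose terms grow exponentially. *)

Set Implicit Arguments.
Unset Strict Implicit.
Unset Printing Implicit Defensive.

Import Order.TTheory GRing.Theory Num.Theory.
Local Open Scope ring_scope.


(** * The basis of a radical square zero algebra *)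

(** The two Ext conditions agree by linear duality. The covers have kernels [S2] and [S1 (+) S3], so
    [Ext^1(M, X) = 0] is a statement about vectors of [X] killed by all arrows; the embeddings have
    cokernels [S2] and [S1 (+) S3], so [Ext^1(X, M) = 0] is a statement about functionals that
    vanish on the images of arrows. A functional factors through [(b, c)] exactly when it vanishes
    on [ker b :&: ker c], through [a] exactly when it vanishes on [ker a], and through [d] exactly
    when it vanishes on [ker d]; this translates one statement into the other. The encoding is
    shaped by [Ext1_zero], which quantifies over all projective resolutions. It is traded for an
    extension property on the kernel of a single projective epimorphism, and homomorphisms from a
    submodule or into a quotient are represented by linear maps on the ambient spaces, with
    A-linearity required only on, or modulo, the submodule. *)

Section PathCoefficients.
Variables (k : fieldType) (Q : quiver).
Local Notation kQ := (path_algebra k Q).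
Implicit Types (f g : kQ).

(** Takes bare functions with proofs of linearity, because expressions such as a coefficient of a
    product carry no canonical linear structure in either argument. *)
Lemma pbasis_bilinear_ind (V : lmodType k) (F G : kQ -> kQ -> V) :
  (forall g, linear (F^~ g)) -> (forall f, linear (F f)) ->
  (forall g, linear (G^~ g)) -> (forall f, linear (G f)) ->
  (forall p q, F (pbasis k p) (pbasis k q) = G (pbasis k p) (pbasis k q)) ->
  forall f g, F f g = G f g.
Proof.
move=> Fl Fr Gl Gr e f g.
have pack (H : kQ -> V) : linear H -> {L : {linear kQ -> V} | H =1 L}.
  move=> lH; pose m := GRing.isLinear.Build _ _ _ _ _ lH.
  pose L : {linear kQ -> V} := HB.pack H m; by exists L.
have [[F1 eF1] [G1 eG1]] := (pack _ (Fl g), pack _ (Gl g)).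
rewrite (eF1 f) (eG1 f); apply: pbasis_ind => p; rewrite -eF1 -eG1.
have [[F2 eF2] [G2 eG2]] := (pack _ (Fr (pbasis k p)), pack _ (Gr (pbasis k p))).
by rewrite eF2 eG2; apply: pbasis_ind => q; rewrite -eF2 -eG2.
Qed.

Lemma qpath_eq (p q : qpath Q) :
  (p == q) = (pstart p == pstart q) && (parrows p == parrows q).
Proof. by rewrite -val_eqE -xpair_eqE -!surjective_pairing. Qed.

(** An arrow factors into two paths in only two ways, with a trivial path on the left or on the
    right. *)
Lemma coef_arrowM (x : arrow Q) f g :
  (f * g)@_(arrow_path x) =
    f@_(trivial_path (source x)) * g@_(arrow_path x) +
    f@_(arrow_path x) * g@_(trivial_path (target x)).
Proof.
pose F f g : k^o := (f * g)@_(arrow_path x).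
pose G f g : k^o := f@_(trivial_path (source x)) * g@_(arrow_path x) +
    f@_(arrow_path x) * g@_(trivial_path (target x)).
apply: (@pbasis_bilinear_ind k^o F G); rewrite /F /G.
- by move=> h c u v; rewrite mulrDl mcoeffD -scalerAl mcoeffZ.
- by move=> h c u v; rewrite mulrDr mcoeffD -scalerAr mcoeffZ.
- move=> h c u v; rewrite !mcoeffD !mcoeffZ !mulrDl scalerDr -!mulrA.
  by rewrite addrACA.
- move=> h c u v; rewrite !mcoeffD !mcoeffZ !mulrDr scalerDr.
  by rewrite !(mulrCA _ c) addrACA.
move=> p q; rewrite pbasisM !mcoeff_pbasis -!natrM !mulnb -natrD.
have [e|n] := pselect (pend p = pstart q).
  rewrite (pmul_basisE k e) mcoeff_pbasis; congr (_%:R).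
  rewrite !qpath_eq /= {1 3 5}/parrows {1}/pstart /=.
  move: e (valP p); rewrite /pend -/(pstart p) -/(parrows p).
  case: (parrows p) => [|y [|z s]] /=.
  - by move=> <- _; rewrite andbF addn0 andbT; case: (_ == _).
  - rewrite andbT => <- /eqP <-; rewrite eqseq_cons andbF add0n eqseq_cons andbT.
    case: (y =P x) => [->|_]; last by rewrite !andbF.
    by rewrite !eqxx.
  by move=> _ _; rewrite !eqseq_cons /= !andbF.
rewrite (pmul_basis0 k n) mcoeff0 !qpath_eq /= {1 3}/parrows /=.
have -> : (pstart p == source x) && (parrows p == [::]) &&
          ((pstart q == source x) && (parrows q == [:: x])) = false.
  apply/negP => /andP[/andP[/eqP ep /eqP es] /andP[/eqP eq _]].
  by apply: n; rewrite /pend es ep eq.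
have -> // : (pstart p == source x) && (parrows p == [:: x]) &&
          ((pstart q == target x) && (parrows q == [::])) = false.
apply/negP => /andP[/andP[/eqP ep /eqP es] /andP[/eqP eq _]].
by apply: n; rewrite /pend es eq.
Qed.

Definition short_path (i : vertex Q + arrow Q) : qpath Q :=
  match i with inl v => trivial_path v | inr x => arrow_path x end.

Lemma short_path_inj : injective short_path.
Proof.
move=> [v|x] [w|y] /(congr1 val) //=; first by case=> ->.
by case=> _ ->.
Qed.

(** By the two product formulas, vanishing on trivial paths ([I1]) and vanishing on all short paths
    ([I2]) are two-sided ideals. The first contains [J], and products of two elements of the first
    lie in the second, which therefore contains [J^2]. *)
Lemma arrow_ideal_sq_coef i f : arrow_ideal_sq f -> f@_(short_path i) = 0.
Proof.
pose I1 (h : kQ) := forall v, h@_(trivial_path v) = 0.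
pose I2 (h : kQ) := forall j, h@_(short_path j) = 0.
have id1 : two_sided_ideal I1.
  split=> [v|g h hg hh v|a g hg]; first by rewrite mcoeff0.
    by rewrite mcoeffB hg hh subr0.
  by split=> v; rewrite [LHS]coef_trivialM hg ?mulr0 ?mul0r.
have id2 : two_sided_ideal I2.
  split=> [j|g h hg hh j|a g hg]; first by rewrite mcoeff0.
    by rewrite mcoeffB hg hh subr0.
  have hv v := hg (inl v); have hx x := hg (inr x); simpl in hv, hx.
  by split=> -[v|x] /=; rewrite (coef_trivialM, coef_arrowM);
    rewrite ?hv ?hx ?(mulr0, mul0r, addr0).
have J1 h : arrow_ideal h -> I1 h.
  apply=> // _ [a ->] v; rewrite mcoeff_pbasis.
  by case: eqP => // /(congr1 val).
move=> hf; suff: I2 f by [].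
apply: hf => // _ [g [h [/J1 hg /J1 hh ->]]] [v|x] /=.
  by rewrite coef_trivialM hg mul0r.
by rewrite coef_arrowM hg hh mul0r mulr0 addr0.
Qed.

Lemma arrow_idealP (p : qpath Q) : parrows p != [::] -> arrow_ideal (pbasis k p).
Proof.
case: p => [[v [|x s]] hp] // _; have := hp; rewrite /= => /andP[/eqP ev hs].
pose t : qpath Q := Sub (target x, s) hs.
have et : pend (arrow_path x) = pstart t by [].
have -> : pbasis k (Sub (v, x :: s) hp) = pbasis k (arrow_path x) * pbasis k t.
  rewrite pbasisM (pmul_basisE _ et); congr pbasis; apply: val_inj.
  by rewrite /= -ev.
have [_ _ hM] := ideal_gen_ideal (fun z : kQ => exists a, z = pbasis k (arrow_path a)).
have h : arrow_ideal (pbasis k (arrow_path x)) by move=> I _; apply; exists x.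
by case: (hM (pbasis k t) _ h).
Qed.

Lemma arrow_ideal_sqP (p : qpath Q) :
  (1 < size (parrows p))%N -> arrow_ideal_sq (pbasis k p).
Proof.
case: p => [[v [|x [|y s]]] hp] // _; have := hp; rewrite /= => /andP[/eqP ev hs].
pose t : qpath Q := Sub (target x, y :: s) hs.
have et : pend (arrow_path x) = pstart t by [].
have -> : pbasis k (Sub (v, [:: x, y & s]) hp) = pbasis k (arrow_path x) * pbasis k t.
  rewrite pbasisM (pmul_basisE _ et); congr pbasis; apply: val_inj.
  by rewrite /= -ev.
move=> I _; apply; exists (pbasis k (arrow_path x)), (pbasis k t).
by split=> //; apply: arrow_idealP.
Qed.

Local Notation A := (rad_square_zero k Q).
Local Notation proj := (@qproj k kQ (arrow_ideal_sq_ideal k Q)).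

Definition rsz_gen (i : vertex Q + arrow Q) : A := proj (pbasis k (short_path i)).

(** Read off the chosen representative; [arrow_ideal_sq_coef] makes the value independent of that
    choice. *)
Definition rsz_coef (i : vertex Q + arrow Q) (u : A) : k^o :=
  (repr (u : quot_algebra (arrow_ideal_sq_ideal k Q)))@_(short_path i).

Lemma rsz_coef_proj i f : rsz_coef i (proj f) = f@_(short_path i).
Proof.
apply/esym/eqP; rewrite -subr_eq0 -mcoeffB; apply/eqP.
by apply: arrow_ideal_sq_coef; apply: (ideal_reprB (arrow_ideal_sq_ideal k Q) f).
Qed.

Lemma rsz_surj (u : A) : exists f, u = proj f.
Proof. by exists (repr (u : quot_algebra (arrow_ideal_sq_ideal k Q))); rewrite qprojK. Qed.

Lemma projZD c f g : c *: (proj f : A) + (proj g : A) = proj (c *: f + g).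
Proof. by rewrite qprojD qprojZ. Qed.

Lemma projM f g : (proj f : A) * (proj g : A) = proj (f * g).
Proof. by rewrite qprojM. Qed.

Lemma rsz_coef_linear i : linear (rsz_coef i).
Proof.
move=> c u v; have [[f ->] [g ->]] := (rsz_surj u, rsz_surj v).
by rewrite projZD !rsz_coef_proj mcoeffD mcoeffZ.
Qed.

HB.instance Definition _ i :=
  GRing.isLinear.Build k A k^o _ (rsz_coef i) (rsz_coef_linear i).

Lemma rsz_coef_gen i j : rsz_coef i (rsz_gen j) = (i == j)%:R.
Proof.
by rewrite rsz_coef_proj mcoeff_pbasis (inj_eq short_path_inj) eq_sym.
Qed.

Lemma rsz_coef_vertexM v (x y : A) :
  rsz_coef (inl v) (x * y) = rsz_coef (inl v) x * rsz_coef (inl v) y.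
Proof.
have [[f ->] [g ->]] := (rsz_surj x, rsz_surj y).
by rewrite projM !rsz_coef_proj coef_trivialM.
Qed.

Lemma rsz_coef_arrowM a (x y : A) :
  rsz_coef (inr a) (x * y) =
    rsz_coef (inl (source a)) x * rsz_coef (inr a) y +
    rsz_coef (inr a) x * rsz_coef (inl (target a)) y.
Proof.
have [[f ->] [g ->]] := (rsz_surj x, rsz_surj y).
by rewrite projM !rsz_coef_proj coef_arrowM.
Qed.

Lemma rsz_coef_vertex1 v : rsz_coef (inl v) 1 = 1.
Proof.
have -> : (1 : A) = proj 1 by [].
rewrite rsz_coef_proj /= /GRing.one /= /pone raddf_sum (bigD1 v) //= big1 => [|w ne].
  by rewrite mcoeff_pbasis eqxx addr0.
rewrite mcoeff_pbasis; case: eqP => // /(congr1 val) [e].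
by rewrite e eqxx in ne.
Qed.

Lemma rsz_coef_arrow1 a : rsz_coef (inr a) 1 = 0.
Proof.
have -> : (1 : A) = proj 1 by [].
rewrite rsz_coef_proj /= /GRing.one /= /pone raddf_sum big1 //= => w _.
by rewrite mcoeff_pbasis; case: eqP => // /(congr1 val).
Qed.

(** Paths with at least two arrows die in the quotient, so the short paths span; with [rsz_coef_gen]
    they form a basis. *)
Lemma rsz_gen_expand (u : A) : u = \sum_i rsz_coef i u *: rsz_gen i.
Proof.
have [f ->] := rsz_surj u.
under eq_bigr do rewrite rsz_coef_proj.
have lin1 : linear (proj : kQ -> A) by move=> c x y; rewrite projZD.
have lin2 : linear (fun f : kQ => \sum_i f@_(short_path i) *: rsz_gen i).
  move=> c x y; rewrite scaler_sumr -big_split; apply: eq_bigr => i _ /=.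
  by rewrite mcoeffD mcoeffZ scalerDl scalerA.
pose L1 : {linear kQ -> A} := HB.pack (proj : kQ -> A) (GRing.isLinear.Build _ _ _ _ _ lin1).
pose L2 : {linear kQ -> A} := HB.pack (fun f : kQ => \sum_i f@_(short_path i) *: rsz_gen i : A)
  (GRing.isLinear.Build _ _ _ _ _ lin2).
apply: (pbasis_ind (F := L1) (G := L2)) => p /=.
have [lt|ge] := ltnP 1 (size (parrows p)).
  have h := arrow_ideal_sqP lt.
  rewrite big1 => [|i _]; last by rewrite arrow_ideal_sq_coef // scale0r.
  rewrite -[RHS](qproj0 (arrow_ideal_sq_ideal k Q)).
  by apply/qproj_eq; rewrite subr0.
have [i ->] : exists i, p = short_path i.
  case: p ge => [[v [|x [|y s]]] hp] // _.
    by exists (inl v); apply: val_inj.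
  by exists (inr x); apply: val_inj => /=; move: hp => /= /andP[/eqP ->].
rewrite (bigD1 i) //= big1 => [|j ne].
  by rewrite mcoeff_pbasis eqxx scale1r addr0.
by rewrite mcoeff_pbasis (inj_eq short_path_inj) eq_sym (negPf ne) scale0r.
Qed.

Lemma rsz_finite_dimensional : finite_dimensional A.
Proof.
pose n := #|{: vertex Q + arrow Q}|.
pose F (u : A) : 'rV[k]_n := \row_j rsz_coef (enum_val j) u.
have lF : linear F by move=> c u v; apply/rowP => j; rewrite !mxE linearP.
pose L : {linear A -> 'rV[k]_n} := HB.pack F (GRing.isLinear.Build _ _ _ _ _ lF); exists n, L.
exists (fun r : 'rV[k]_n => \sum_i r 0 (enum_rank i) *: rsz_gen i) => [u|r] /=.
  rewrite [RHS]rsz_gen_expand; apply: eq_bigr => i _.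
  by rewrite mxE enum_rankK.
apply/rowP => j; rewrite mxE linear_sum (bigD1 (enum_val j)) //= big1 => [|i ne].
  by rewrite enum_valK linearZ /= rsz_coef_gen eqxx addr0 /GRing.scale /= mulr1.
by rewrite linearZ /= rsz_coef_gen eq_sym (negPf ne) scaler0.
Qed.

End PathCoefficients.

(** * Modules, projective resolutions and Ext *)

Section LinearMaps.
Variables (k : fieldType) (U V W : vectType k).

Lemma linfunE (f : U -> V) x : linear f -> linfun f x = f x.
Proof.
move=> lf; pose L : {linear U -> V} := HB.pack f (GRing.isLinear.Build k U V _ f lf).
by rewrite -[f]/(L : U -> V) lfunE.
Qed.

Lemma lker_invB (f : 'Hom(U, V)) x : (f^-1)%VF (f x) - x \in lker f.
Proof. by rewrite memv_ker linearB /= limg_lfunVK ?subrr // memv_img ?memvf. Qed.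

(** Together with [lker_invB] this makes [g \o f^-1] a factorization of [g] through [f] whenever [g]
    kills [lker f]; every descent to an image or a quotient below is obtained so. *)
Lemma eq_lkerB (V' : vectType k) (f : 'Hom(U, V)) (g : 'Hom(U, V')) x y :
  (lker f <= lker g)%VS -> x - y \in lker f -> g x = g y.
Proof.
by move=> sfg /(subvP sfg); rewrite memv_ker linearB subr_eq0 => /eqP.
Qed.

Lemma limg_full_inv (f : 'Hom(U, V)) y : limg f = fullv -> f ((f^-1)%VF y) = y.
Proof. by move=> e; rewrite limg_lfunVK // e memvf. Qed.

Lemma limg_fullP (f : 'Hom(U, V)) : (forall y, exists x, f x = y) -> limg f = fullv.
Proof.
move=> h; apply/eqP; rewrite eqEsubv subvf; apply/subvP => y _.
by have [x <-] := h y; rewrite memv_img ?memvf.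
Qed.

End LinearMaps.

Section ModuleTheory.
Variables (k : fieldType) (A : algType k).
Implicit Types M N X Y P Q I : rmod A.

Lemma ract_mul1 M x : ract M 1 x = x.
Proof. by rewrite ract1 id_lfunE. Qed.

Lemma ractA M a b x : ract M (a * b) x = ract M b (ract M a x).
Proof. by rewrite ractM comp_lfunE. Qed.

Lemma is_hom_comp M N X (g : 'Hom(N, X)) (f : 'Hom(M, N)) :
  is_hom g -> is_hom f -> is_hom (g \o f)%VF.
Proof. by move=> hg hf a x; rewrite !comp_lfunE /= hf hg. Qed.

Lemma is_homD M N (f g : 'Hom(M, N)) : is_hom f -> is_hom g -> is_hom (f + g).
Proof. by move=> hf hg a x; rewrite !add_lfunE hf hg linearD. Qed.

Lemma is_homN M N (f : 'Hom(M, N)) : is_hom f -> is_hom (- f).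
Proof. by move=> hf a x; rewrite !opp_lfunE hf linearN. Qed.

Lemma is_homB M N (f g : 'Hom(M, N)) : is_hom f -> is_hom g -> is_hom (f - g).
Proof. by move=> hf hg; apply/is_homD/is_homN. Qed.

Lemma is_hom0 M N : is_hom (0 : 'Hom(M, N)).
Proof. by move=> a x; rewrite !zero_lfunE linear0. Qed.

Lemma is_hom1 M : is_hom (\1%VF : 'End(M)).
Proof. by move=> a x; rewrite !id_lfunE. Qed.

Lemma is_hom_sum (J : finType) M N (f : J -> 'Hom(M, N)) :
  (forall i, is_hom (f i)) -> is_hom (\sum_i f i).
Proof.
move=> hf; apply: (big_ind (fun g => is_hom g)) => //; first exact: is_hom0.
by move=> g h; apply: is_homD.
Qed.

Lemma submodP M (U : {vspace M}) :
  submodule U <-> forall a x, x \in U -> ract M a x \in U.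
Proof.
split=> [sU a x xU|h a]; first by apply: (subvP (sU a)); apply: memv_img.
by apply/subvP => _ /memv_imgP[x xU ->]; apply: h.
Qed.

Lemma submod_lker M N (f : 'Hom(M, N)) : is_hom f -> submodule (lker f).
Proof.
move=> hf; apply/submodP => a x; rewrite !memv_ker hf => /eqP ->.
by rewrite linear0.
Qed.

Lemma submod_limg M N (f : 'Hom(M, N)) : is_hom f -> submodule (limg f).
Proof.
move=> hf; apply/submodP => a _ /memv_imgP[x _ ->].
by rewrite -hf memv_img ?memvf.
Qed.

Section Submodule.
Variables (M : rmod A) (U : {vspace M}) (sU : submodule U).

Definition smod_fun (a : A) (u : subvs_of U) : subvs_of U :=
  vsproj U (ract M a (vsval u)).

Lemma smod_fun_linear a : linear (smod_fun a).
Proof. by move=> c u v; rewrite /smod_fun !linearP. Qed.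

Lemma vsval_smod_fun a u : vsval (smod_fun a u) = ract M a (vsval u).
Proof. by rewrite vsprojK // (submodP U).1 // subvsP. Qed.

Definition smod_act (a : A) : 'End(subvs_of U) := linfun (smod_fun a).

Lemma smod_act_linear : linear smod_act.
Proof.
move=> c a b; apply/lfunP => u; rewrite add_lfunE scale_lfunE !(linfunE _ (smod_fun_linear _)).
by rewrite /smod_fun !linearP /= add_lfunE scale_lfunE linearP.
Qed.

HB.instance Definition _ :=
  GRing.isLinear.Build k A 'End(subvs_of U) _ smod_act smod_act_linear.

Lemma smod_act1 : smod_act 1 = \1%VF.
Proof.
apply/lfunP => u; apply: val_inj; rewrite (linfunE _ (smod_fun_linear _)) id_lfunE.
by rewrite [LHS]vsval_smod_fun ract_mul1.
Qed.

Lemma smod_actM a b : smod_act (a * b) = (smod_act b \o smod_act a)%VF.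
Proof.
apply/lfunP => u; apply: val_inj; rewrite comp_lfunE !(linfunE _ (smod_fun_linear _)).
by rewrite [LHS]vsval_smod_fun [RHS]vsval_smod_fun vsval_smod_fun ractA.
Qed.

Definition smod : rmod A := RMod smod_act1 smod_actM.

Definition smod_val : 'Hom(smod, M) := linfun vsval.

Lemma smod_valE x : smod_val x = vsval (x : subvs_of U).
Proof. by rewrite lfunE. Qed.

Lemma smod_val_in x : smod_val x \in U.
Proof. by rewrite smod_valE subvsP. Qed.

Lemma smod_val_hom : is_hom smod_val.
Proof. by move=> a x; rewrite !smod_valE /= (linfunE _ (smod_fun_linear _)) vsval_smod_fun. Qed.

Lemma smod_val_inj : injective smod_val.
Proof. by move=> x y; rewrite !smod_valE => /val_inj. Qed.

Lemma smod_valK (x : smod) : vsproj U (smod_val x) = x.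
Proof. by rewrite smod_valE vsvalK. Qed.

Lemma smod_projK y : y \in U -> smod_val (vsproj U y : smod) = y.
Proof. by move=> yU; rewrite smod_valE vsprojK. Qed.

Lemma smod_val_onto y : y \in U -> exists x, smod_val x = y.
Proof. by move=> yU; exists (vsproj U y : smod); apply: smod_projK. Qed.

End Submodule.

Lemma ract_dsum M N a (x : dsum M N) : ract (dsum M N) a x = (ract M a x.1, ract N a x.2).
Proof. by rewrite /= lfunE. Qed.

Section DirectSums.
Variables M N X Y : rmod A.

Definition dsum_map (f : 'Hom(M, X)) (g : 'Hom(N, Y)) :
    'Hom(dsum M N, dsum X Y) :=
  linfun (fun x => (f x.1, g x.2)).

Lemma dsum_mapE f g x : dsum_map f g x = (f x.1, g x.2).
Proof. by rewrite linfunE // => c u v; rewrite !linearP. Qed.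

Lemma dsum_map_hom f g : is_hom f -> is_hom g -> is_hom (dsum_map f g).
Proof. by move=> hf hg a x; rewrite !dsum_mapE !ract_dsum hf hg. Qed.

Lemma dsum_map_onto f g : limg f = fullv -> limg g = fullv ->
  limg (dsum_map f g) = fullv.
Proof.
move=> hf hg; apply: limg_fullP => -[y z].
exists ((f^-1)%VF y, (g^-1)%VF z).
by rewrite dsum_mapE /= !limg_full_inv.
Qed.

Lemma mem_lker_dsum_map f g x :
  (x \in lker (dsum_map f g)) = (x.1 \in lker f) && (x.2 \in lker g).
Proof. by rewrite !memv_ker dsum_mapE. Qed.

Lemma mem_limg_dsum_map f g y :
  (y \in limg (dsum_map f g)) = (y.1 \in limg f) && (y.2 \in limg g).
Proof.
apply/memv_imgP/andP => [[x _ ->]|[/memv_imgP[u _ eu] /memv_imgP[v _ ev]]].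
  by rewrite dsum_mapE !memv_img ?memvf.
by exists (u, v); rewrite ?memvf // dsum_mapE -eu -ev -surjective_pairing.
Qed.

Definition dsum_copair (f : 'Hom(M, X)) (g : 'Hom(N, X)) : 'Hom(dsum M N, X) :=
  linfun (fun x => f x.1 + g x.2).

Lemma dsum_copairE f g x : dsum_copair f g x = f x.1 + g x.2.
Proof.
rewrite linfunE // => c u v /=.
by rewrite !linearP /= scalerDr addrACA.
Qed.

Lemma dsum_copair_hom f g : is_hom f -> is_hom g -> is_hom (dsum_copair f g).
Proof. by move=> hf hg a x; rewrite !dsum_copairE ract_dsum hf hg linearD. Qed.

Definition dsum_pair (f : 'Hom(X, M)) (g : 'Hom(X, N)) : 'Hom(X, dsum M N) :=
  linfun (fun x => (f x, g x)).

Lemma dsum_pairE f g x : dsum_pair f g x = (f x, g x).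
Proof. by rewrite linfunE // => c u v /=; rewrite !linearP. Qed.

Lemma dsum_pair_hom f g : is_hom f -> is_hom g -> is_hom (dsum_pair f g).
Proof. by move=> hf hg a x; rewrite ract_dsum !dsum_pairE hf hg. Qed.

Definition dsum_fst : 'Hom(dsum M N, M) := linfun fst.
Definition dsum_snd : 'Hom(dsum M N, N) := linfun snd.
Definition dsum_inl : 'Hom(M, dsum M N) := linfun (fun x => (x, 0)).
Definition dsum_inr : 'Hom(N, dsum M N) := linfun (fun y => (0, y)).

Lemma dsum_fstE x : dsum_fst x = x.1. Proof. by rewrite linfunE. Qed.
Lemma dsum_sndE x : dsum_snd x = x.2. Proof. by rewrite linfunE. Qed.

Lemma dsum_inlE x : dsum_inl x = (x, 0).
Proof. by rewrite linfunE // => c u v; apply: injective_projections; rewrite /= ?scaler0 ?addr0. Qed.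

Lemma dsum_inrE x : dsum_inr x = (0, x).
Proof. by rewrite linfunE // => c u v; apply: injective_projections; rewrite /= ?scaler0 ?addr0. Qed.

Lemma dsum_fst_hom : is_hom dsum_fst.
Proof. by move=> a x; rewrite !dsum_fstE ract_dsum. Qed.

Lemma dsum_snd_hom : is_hom dsum_snd.
Proof. by move=> a x; rewrite !dsum_sndE ract_dsum. Qed.

Lemma dsum_inl_hom : is_hom dsum_inl.
Proof. by move=> a x; rewrite !dsum_inlE ract_dsum /= linear0. Qed.

Lemma dsum_inr_hom : is_hom dsum_inr.
Proof. by move=> a x; rewrite !dsum_inrE ract_dsum /= linear0. Qed.

End DirectSums.

Section Powers.
Variables (M X : rmod A) (n : nat).

Lemma ract_dpow a (x : dpow M n) i : ract (dpow M n) a x i = ract M a (x i).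
Proof. by rewrite /= lfunE ffunE. Qed.

Definition dpow_proj (i : 'I_n) : 'Hom(dpow M n, M) :=
  linfun (fun x : {ffun 'I_n -> M} => x i).

Lemma dpow_projE i x : dpow_proj i x = (x : {ffun 'I_n -> M}) i.
Proof. by rewrite linfunE // => c u v; rewrite !ffunE. Qed.

Lemma dpow_proj_hom i : is_hom (dpow_proj i).
Proof. by move=> a x; rewrite !dpow_projE ract_dpow. Qed.

Definition dpow_tuple (f : 'I_n -> 'Hom(X, M)) : 'Hom(X, dpow M n) :=
  linfun (fun x => [ffun i => f i x]).

Lemma dpow_tupleE f x : dpow_tuple f x = [ffun i => f i x].
Proof. by rewrite linfunE // => c u v; apply/ffunP => i; rewrite !ffunE linearP. Qed.

Lemma dpow_tuple_hom f : (forall i, is_hom (f i)) -> is_hom (dpow_tuple f).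
Proof.
move=> hf a x; rewrite !dpow_tupleE; apply/ffunP => i.
by rewrite ract_dpow !ffunE hf.
Qed.

Definition dpow_cotuple (f : 'I_n -> 'Hom(M, X)) : 'Hom(dpow M n, X) :=
  \sum_i (f i \o dpow_proj i)%VF.

Lemma dpow_cotupleE f x :
  dpow_cotuple f x = \sum_i f i ((x : {ffun 'I_n -> M}) i).
Proof.
by rewrite sum_lfunE; apply: eq_bigr => i _; rewrite comp_lfunE dpow_projE.
Qed.

Lemma dpow_cotuple_hom f : (forall i, is_hom (f i)) -> is_hom (dpow_cotuple f).
Proof. by move=> hf; apply: is_hom_sum => i; apply/is_hom_comp/dpow_proj_hom. Qed.

End Powers.

Lemma projective_dsum P Q : projective P -> projective Q -> projective (dsum P Q).
Proof.
move=> pP pQ M N g f hg og hf.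
have [u [hu eu]] := pP M N g _ hg og (is_hom_comp hf (@dsum_inl_hom P Q)).
have [v [hv ev]] := pQ M N g _ hg og (is_hom_comp hf (@dsum_inr_hom P Q)).
exists (dsum_copair u v); split; first exact: dsum_copair_hom.
apply/lfunP => -[x y]; rewrite comp_lfunE dsum_copairE linearD /=.
rewrite -[g (u x)]comp_lfunE -[g (v y)]comp_lfunE eu ev !comp_lfunE.
rewrite dsum_inlE dsum_inrE -linearD; congr (f _).
by apply: injective_projections; rewrite /= ?addr0 ?add0r.
Qed.

Lemma projective_dpow P n : projective P -> projective (dpow P n).
Proof.
move=> pP M N g f hg og hf.
pose inj (i : 'I_n) : 'Hom(P, dpow P n) :=
  dpow_tuple (fun j => if j == i then \1%VF else 0).
have hinj i : is_hom (inj i).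
  by apply: dpow_tuple_hom => j; case: eqP => _; [apply: is_hom1|apply: is_hom0].
have lift i := pP M N g _ hg og (is_hom_comp hf (hinj i)).
pose u i := projT1 (cid (lift i)).
have [hu eu] : (forall i, is_hom (u i)) /\ forall i x, g (u i x) = f (inj i x).
  by split=> [i|i x]; rewrite /u; case: cid => h [hh eh] //=;
    rewrite -!comp_lfunE eh.
exists (dpow_cotuple u); split; first exact: dpow_cotuple_hom.
apply/lfunP => x; rewrite comp_lfunE dpow_cotupleE linear_sum.
rewrite (eq_bigr _ (fun i _ => eu i _)).
rewrite -linear_sum; congr (f _); apply/ffunP => j; rewrite sum_ffunE.
rewrite (bigD1 j) //= big1 => [|i ne]; rewrite dpow_tupleE ffunE.
  by rewrite eqxx id_lfunE addr0.
by rewrite eq_sym (negPf ne) zero_lfunE.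
Qed.

(** * First extensions computed on the kernel of a projective epimorphism *)

Definition hom_on M N (K : {vspace M}) (h : 'Hom(M, N)) : Prop :=
  forall a x, x \in K -> h (ract M a x) = ract N a (h x).

(** Surjectivity of the restriction [Hom(M, X) -> Hom(K, X)]. For [M] projective and [K] a
    submodule, its cokernel is [Ext^1(M / K, X)]. *)
Definition ext_onto M (K : {vspace M}) X : Prop :=
  forall h : 'Hom(M, X), hom_on K h ->
    exists g : 'Hom(M, X), is_hom g /\ forall x, x \in K -> g x = h x.

Definition proj_epi N P (p : 'Hom(P, N)) : Prop :=
  [/\ projective P, is_hom p & limg p = fullv].

Lemma cover_dsum M N P Q (p : 'Hom(P, M)) (q : 'Hom(Q, N)) :
  proj_epi p -> proj_epi q -> proj_epi (dsum_map p q).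
Proof.
move=> [pP hp op] [pQ hq oq]; split; first exact: projective_dsum.
  exact: dsum_map_hom.
exact: dsum_map_onto.
Qed.

Lemma cover_id P : projective P -> proj_epi (\1%VF : 'End(P)).
Proof. by move=> pP; split=> //; [apply: is_hom1|apply: lim1g]. Qed.

Lemma ext_onto_id P X : ext_onto (lker (\1%VF : 'End(P))) X.
Proof.
move=> h _; exists 0; split; first exact: is_hom0.
by move=> x; rewrite memv_ker id_lfunE => /eqP ->; rewrite !linear0.
Qed.

Lemma ext_onto_dsum M N P Q (p : 'Hom(P, M)) (q : 'Hom(Q, N)) X :
  ext_onto (lker (dsum_map p q)) X <-> ext_onto (lker p) X /\ ext_onto (lker q) X.
Proof.
split=> [E|[Ep Eq] h hh]; first split.
- move=> h hh; have [a x|g [hg eg]] := E (h \o @dsum_fst P Q)%VF.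
    rewrite mem_lker_dsum_map => /andP[xK _].
    by rewrite !comp_lfunE !dsum_fstE ract_dsum hh.
  exists (g \o @dsum_inl P Q)%VF; split.
    exact/is_hom_comp/dsum_inl_hom.
  move=> x xK; rewrite comp_lfunE dsum_inlE eg ?mem_lker_dsum_map ?xK ?mem0v //.
  by rewrite comp_lfunE dsum_fstE.
- move=> h hh; have [a x|g [hg eg]] := E (h \o @dsum_snd P Q)%VF.
    rewrite mem_lker_dsum_map => /andP[_ xK].
    by rewrite !comp_lfunE !dsum_sndE ract_dsum hh.
  exists (g \o @dsum_inr P Q)%VF; split.
    exact/is_hom_comp/dsum_inr_hom.
  move=> x xK; rewrite comp_lfunE dsum_inrE eg ?mem_lker_dsum_map ?xK ?mem0v //.
  by rewrite comp_lfunE dsum_sndE.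
have [a x xK|g1 [hg1 e1]] := Ep (h \o @dsum_inl P Q)%VF.
  by rewrite !comp_lfunE -hh ?dsum_inl_hom // mem_lker_dsum_map dsum_inlE xK mem0v.
have [a x xK|g2 [hg2 e2]] := Eq (h \o @dsum_inr P Q)%VF.
  by rewrite !comp_lfunE -hh ?dsum_inr_hom // mem_lker_dsum_map dsum_inrE xK mem0v.
exists (dsum_copair g1 g2); split; first exact: dsum_copair_hom.
move=> [x y]; rewrite mem_lker_dsum_map => /andP[/= xK yK].
rewrite dsum_copairE e1 // e2 // !comp_lfunE -linearD dsum_inlE dsum_inrE.
by congr (h _); apply/pair_eqP; rewrite /= addr0 add0r !eqxx.
Qed.

(** A form of Schanuel's lemma. The comparison maps [u : P -> Q] and [w : Q -> P] over [N] make
    [t = u w - 1] take values in [lker q]. If [g] extends [h u], then [g w - h t] agrees on [lker q]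
    with [h u w - h (u w - 1) = h]. *)
Lemma ext_onto_cover N P Q (p : 'Hom(P, N)) (q : 'Hom(Q, N)) X :
  proj_epi p -> proj_epi q -> ext_onto (lker p) X -> ext_onto (lker q) X.
Proof.
move=> [pP hp op] [pQ hq oq] E h hh.
have [u [hu eu]] := pP _ _ _ _ hq oq hp.
have [w [hw ew]] := pQ _ _ _ _ hp op hq.
have {}eu x : q (u x) = p x by rewrite -comp_lfunE eu.
have {}ew x : p (w x) = q x by rewrite -comp_lfunE ew.
have [a x|g [hg eg]] := E (h \o u)%VF.
  rewrite memv_ker => /eqP px.
  by rewrite !comp_lfunE hu hh // memv_ker eu px.
pose t : 'End(Q) := (u \o w - \1)%VF.
have ht : is_hom t by apply: is_homB; [exact: is_hom_comp|exact: is_hom1].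
have tK x : t x \in lker q.
  by rewrite memv_ker !lfun_simp /= linearB /= eu ew subrr.
exists (g \o w - (h \o t))%VF; split.
  apply: is_homB; first exact: is_hom_comp.
  by move=> a x; rewrite !comp_lfunE ht hh.
move=> x; rewrite memv_ker => /eqP qx.
rewrite !lfun_simp /= eg ?memv_ker ?ew ?qx //.
by rewrite !lfun_simp /= linearB /= opprB addrC subrK.
Qed.

Section EnoughProjectives.
Hypothesis enough : forall N, exists P (p : 'Hom(P, N)), proj_epi p.

Let cov N : rmod A := projT1 (cid (enough N)).
Let covm N : 'Hom(cov N, N) := projT1 (cid (projT2 (cid (enough N)))).
Let covmP N : proj_epi (covm N) := projT2 (cid (projT2 (cid (enough N)))).
Let covm_hom N : is_hom (covm N). Proof. by case: (covmP N). Qed.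
Let syz N : rmod A := smod (submod_lker (@covm_hom N)).

(** Without a resolution at hand, [Ext1_zero] could hold vacuously. The resolution is spliced from
    covers of the iterated syzygies [S n]. *)
Lemma proj_resolution_exists N : inhabited (proj_resolution N).
Proof.
pose S n := iter n syz N.
pose d n : 'Hom(cov (S n.+1), cov (S n)) :=
  (smod_val (submod_lker (@covm_hom (S n))) \o covm (S n.+1))%VF.
have hd n : is_hom (d n).
  by apply: is_hom_comp; [apply: smod_val_hom|apply: covm_hom].
have Id n : limg (d n) = lker (covm (S n)).
  apply/vspaceP => y; apply/memv_imgP/idP => [[x _ ->]|yK].
    by rewrite comp_lfunE smod_val_in.
  have [x ex] := smod_val_onto (submod_lker (@covm_hom (S n))) yK.
  have [_ _ oc] := covmP (S n.+1).
  exists ((covm (S n.+1))^-1%VF x); rewrite ?memvf // comp_lfunE.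
  by rewrite limg_full_inv.
have Kd n : lker (d n) = lker (covm (S n.+1)).
  apply/vspaceP => y; rewrite !memv_ker comp_lfunE.
  by rewrite -(inj_eq (@smod_val_inj _ _ (submod_lker (@covm_hom (S n))))) linear0.
split; refine (@ProjResolution k A N (fun n => cov (S n)) d (covm N) hd _ _ _ _ _).
- exact: covm_hom.
- by move=> n; case: (covmP (S n)).
- by case: (covmP N).
- exact: Id.
- by move=> n; rewrite Id Kd.
Qed.

(** A cocycle on the term of degree 1 kills the image of the next differential, so it descends along
    [res_diff R 0] to the kernel of the augmentation; coboundaries are the maps that extend to the
    term of degree 0. [ext_onto_cover] then moves between the augmentation and [p]. *)
Lemma Ext1_zero_cover N P (p : 'Hom(P, N)) X :
  proj_epi p -> Ext1_zero N X <-> ext_onto (lker p) X.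
Proof.
move=> cp; split=> [E|E R f hf fd].
  have [R] := proj_resolution_exists N.
  apply: (ext_onto_cover (p := res_aug R)) => //.
    by split; [apply: res_proj|apply: res_aug_hom|apply: res_aug_onto].
  move=> h hh; have [a x||g [hg eg]] := E R (h \o res_diff R 0)%VF.
  - by rewrite !comp_lfunE res_diff_hom hh // -res_exact0 memv_img ?memvf.
  - apply/lfunP => x; rewrite !comp_lfunE zero_lfunE.
    have : res_diff R 1 x \in lker (res_diff R 0).
      by rewrite -res_exact memv_img ?memvf.
    by rewrite memv_ker => /eqP ->; rewrite linear0.
  exists g; split=> // y; rewrite -res_exact0 => /memv_imgP[x _ ->].
  by rewrite -!comp_lfunE eg.
have cR : proj_epi (res_aug R).
  by split; [apply: res_proj|apply: res_aug_hom|apply: res_aug_onto].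
pose h : 'Hom(R 0%N, X) := (f \o (res_diff R 0)^-1)%VF.
have eh z : h (res_diff R 0 z) = f z.
  rewrite comp_lfunE; apply: (@eq_lkerB _ _ _ _ (res_diff R 0)); last exact: lker_invB.
  rewrite -res_exact; apply/subvP => _ /memv_imgP[x _ ->].
  by rewrite memv_ker -comp_lfunE fd zero_lfunE.
have [a y|g [hg eg]] := ext_onto_cover cp cR E (h := h).
  rewrite -res_exact0 => /memv_imgP[z _ ->].
  by rewrite -res_diff_hom !eh hf.
exists g; split=> //; apply/lfunP => z.
by rewrite comp_lfunE eg ?eh // -res_exact0 memv_img ?memvf.
Qed.

End EnoughProjectives.

(** * Injective modules and dimension shifting *)

Definition injective_module I : Prop :=
  forall M (K : {vspace M}), submodule K -> ext_onto K I.

Definition hom_mod M N (U : {vspace N}) (t : 'Hom(M, N)) : Prop :=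
  forall a x, t (ract M a x) - ract N a (t x) \in U.

(** Surjectivity of [Hom(M, I) -> Hom(M, I / U)]; for [I] injective and [U] a submodule this means
    [Ext^1(M, U) = 0]. *)
Definition lifts_mod M I (U : {vspace I}) : Prop :=
  forall t : 'Hom(M, I), hom_mod U t ->
    exists g : 'Hom(M, I), is_hom g /\ forall x, g x - t x \in U.

Lemma injective_dsum I J :
  injective_module I -> injective_module J -> injective_module (dsum I J).
Proof.
move=> iI iJ M K sK h hh.
have [a x xK|g1 [hg1 e1]] := iI M K sK (@dsum_fst I J \o h)%VF.
  by rewrite !comp_lfunE hh // dsum_fst_hom.
have [a x xK|g2 [hg2 e2]] := iJ M K sK (@dsum_snd I J \o h)%VF.
  by rewrite !comp_lfunE hh // dsum_snd_hom.
exists (dsum_pair g1 g2); split; first exact: dsum_pair_hom.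
move=> x xK; rewrite dsum_pairE e1 // e2 // !comp_lfunE dsum_fstE dsum_sndE.
by rewrite -surjective_pairing.
Qed.

Lemma ext_onto_dsum_r M (K : {vspace M}) X Y :
  ext_onto K (dsum X Y) <-> ext_onto K X /\ ext_onto K Y.
Proof.
split=> [E|[EX EY] h hh]; first split.
- move=> h hh; have [a x xK|g [hg eg]] := E (@dsum_inl X Y \o h)%VF.
    by rewrite !comp_lfunE hh // dsum_inl_hom.
  exists (@dsum_fst X Y \o g)%VF; split; first exact/is_hom_comp/hg/dsum_fst_hom.
  by move=> x xK; rewrite comp_lfunE eg // comp_lfunE dsum_inlE dsum_fstE.
- move=> h hh; have [a x xK|g [hg eg]] := E (@dsum_inr X Y \o h)%VF.
    by rewrite !comp_lfunE hh // dsum_inr_hom.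
  exists (@dsum_snd X Y \o g)%VF; split; first exact/is_hom_comp/hg/dsum_snd_hom.
  by move=> x xK; rewrite comp_lfunE eg // comp_lfunE dsum_inrE dsum_sndE.
have [a x xK|g1 [hg1 e1]] := EX (@dsum_fst X Y \o h)%VF.
  by rewrite !comp_lfunE hh // dsum_fst_hom.
have [a x xK|g2 [hg2 e2]] := EY (@dsum_snd X Y \o h)%VF.
  by rewrite !comp_lfunE hh // dsum_snd_hom.
exists (dsum_pair g1 g2); split; first exact: dsum_pair_hom.
move=> x xK; rewrite dsum_pairE e1 // e2 // !comp_lfunE dsum_fstE dsum_sndE.
by rewrite -surjective_pairing.
Qed.

(* Dimension shifting along [0 -> X -> I -> I / X -> 0], with homomorphisms to
   [I / X] presented as linear maps to [I] that are A-linear modulo [X]. *)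
Lemma ext_onto_lifts_mod M P (p : 'Hom(P, M)) X I (j : 'Hom(X, I)) :
  proj_epi p -> is_hom j -> injective j -> injective_module I ->
  ext_onto (lker p) X <-> lifts_mod M (limg j).
Proof.
move=> [pP hp op] hj ij iI; have sj := submod_limg hj.
have jin x : j x \in limg j by rewrite memv_img ?memvf.
have jinv y : y \in limg j -> j ((j^-1)%VF y) = y by apply: limg_lfunVK.
split=> [E t ht|L h hh].
  (* The preimage of [limg j] under [D] is the pullback of [M -> I / X <- I]. It projects onto [M],
     so [p] lifts to it, and the second component of the lift is a homomorphism [H : P -> I] that
     induces [t] modulo [X]. *)
  pose D := ((t \o @dsum_fst M I) - @dsum_snd M I)%VF.
  have DE z : D z = t z.1 - z.2.
    by rewrite add_lfunE comp_lfunE opp_lfunE dsum_fstE dsum_sndE.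
  have sE : @submodule k A (dsum M I) (D @^-1: limg j)%VS.
    apply/submodP => a z; rewrite -!memv_preim !DE ract_dsum /= => zD.
    rewrite -(subrK (ract I a (t z.1)) (t _)) -addrA -linearB.
    by rewrite memvD ?(submodP _).1 ?ht.
  have hq : is_hom (@dsum_fst M I \o smod_val sE)%VF.
    exact: (is_hom_comp (@dsum_fst_hom M I) (@smod_val_hom _ _ sE)).
  have oq : limg (@dsum_fst M I \o smod_val sE)%VF = fullv.
    apply: limg_fullP => x.
    have [|z ez] := @smod_val_onto _ _ sE (x, t x); last first.
      by exists z; rewrite comp_lfunE ez dsum_fstE.
    by rewrite -memv_preim DE subrr mem0v.
  have [r [hr er]] := pP _ _ _ _ hq oq hp.
  pose H : 'Hom(P, I) := (@dsum_snd M I \o smod_val sE \o r)%VF.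
  have hH : is_hom H.
    apply: is_hom_comp hr; exact: (is_hom_comp (@dsum_snd_hom M I) (@smod_val_hom _ _ sE)).
  have HU y : t (p y) - H y \in limg j.
    have := smod_val_in (sU := sE) (r y); rewrite -memv_preim DE.
    have -> : (smod_val sE (r y)).1 = p y by rewrite -er !comp_lfunE dsum_fstE.
    by rewrite /H !comp_lfunE dsum_sndE.
  clearbody H.
  have HK y : y \in lker p -> H y \in limg j.
    by rewrite memv_ker => /eqP py; have := HU y; rewrite py linear0 sub0r memvN.
  (* On [lker p] the map [H] takes values in [X]; subtracting an extension of this restriction to
     [P] leaves a map that kills [lker p] and so descends to [M], unchanged modulo [X]. *)
  have [a y yK|G [hG eG]] := E (j^-1 \o H)%VF.
    apply: ij; rewrite !comp_lfunE jinv; last first.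
      by rewrite hH (submodP _).1 // HK.
    by rewrite hj jinv ?hH // HK.
  pose g0 := (H - (j \o G))%VF.
  have hg0 : is_hom g0 by apply: is_homB => //; apply: is_hom_comp.
  have sub0 : (lker p <= lker g0)%VS.
    apply/subvP => y yK; rewrite memv_ker !lfun_simp /= eG // comp_lfunE.
    by rewrite jinv ?subrr // HK.
  exists (g0 \o p^-1)%VF; split=> [a x|x].
    rewrite !comp_lfunE -hg0; apply: (eq_lkerB sub0).
    by rewrite memv_ker linearB /= hp !limg_full_inv // subrr.
  rewrite -{2}(limg_full_inv x op) !lfun_simp /=; set y := (p^-1)%VF x.
  by rewrite addrAC memvB // -opprB memvN.
(* Conversely, injectivity extends [j h] to [H] on [P], and [H] induces a homomorphism [M -> I / X].
   If [g] lifts the latter, [H - g p] takes values in [X] and restricts to [h] on [lker p]. *)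
have [a y yK|H [hH eH]] := iI P _ (submod_lker hp) (j \o h)%VF.
  by rewrite !comp_lfunE hh // hj.
pose t : 'Hom(M, I) := (H \o p^-1)%VF.
have tp y : t (p y) - H y \in limg j.
  rewrite comp_lfunE -linearB /= eH ?lker_invB // comp_lfunE; exact: jin.
have [a x|g [hg eg]] := L t.
  rewrite -(limg_full_inv x op); set y := (p^-1)%VF x.
  rewrite -hp -(subrK (H (ract P a y)) (t _)) {2}hH -addrA -linearB.
  by rewrite memvD // (submodP _).1 // -opprB memvN.
pose g0 : 'Hom(P, I) := (H - (g \o p))%VF.
have hg0 : is_hom g0 by apply: is_homB => //; apply: is_hom_comp.
have g0U y : g0 y \in limg j.
  rewrite !lfun_simp /= -[H y](subrK (t (p y))) -addrA -opprB memvD ?memvN //.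
  by rewrite -opprB memvN.
exists (j^-1 \o g0)%VF; split=> [a y|y yK]; apply: ij.
  rewrite hj !comp_lfunE !jinv //.
rewrite comp_lfunE jinv // !lfun_simp /= eH // comp_lfunE.
by move: yK; rewrite memv_ker => /eqP ->; rewrite linear0 subr0.
Qed.

(** The tuple [U : X -> M^n] is split by [V : M^n -> X], so [lker V] is a complement of [X] in
    [M^n]. *)
Lemma in_add_split M X n (u : 'I_n -> 'Hom(X, M)) (v : 'I_n -> 'Hom(M, X)) :
  (forall i, is_hom (u i)) -> (forall i, is_hom (v i)) ->
  (forall x, \sum_i v i (u i x) = x) -> in_add M X.
Proof.
move=> hu hv e.
have hU := dpow_tuple_hom hu; have hV := dpow_cotuple_hom hv.
set U := dpow_tuple u in hU; set V := dpow_cotuple v in hV.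
have VU x : V (U x) = x.
  rewrite dpow_cotupleE -[RHS]e; apply: eq_bigr => i _.
  by rewrite dpow_tupleE ffunE.
(* [in_add] demands a positive power. For [n = 0] the empty sum forces [X = 0], and [M] itself is a
   complement of [X] in [M^1]. *)
have [n0|n_gt0] := posnP n.
  exists 1%N, M; split=> //; pose F : 'Hom(dsum X M, dpow M 1) :=
    (dpow_tuple (fun=> \1%VF) \o @dsum_snd X M)%VF.
  have hF : is_hom F.
    by apply/is_hom_comp/dsum_snd_hom/dpow_tuple_hom => i; apply: is_hom1.
  have x0 (x : X) : x = 0 by rewrite -[x]e big1 // => i; have := ltn_ord i; rewrite {2}n0.
  exists F; split=> //; exists (fun y => (0, (y : {ffun 'I_1 -> M}) ord0)).
    move=> [x y]; rewrite comp_lfunE dpow_tupleE ffunE id_lfunE dsum_sndE.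
    by rewrite [x]x0.
  move=> y; apply/ffunP => i.
  by rewrite comp_lfunE dpow_tupleE ffunE id_lfunE dsum_sndE [i]ord1.
have sK := submod_lker hV; exists n, (smod sK); split=> //.
exists (dsum_copair U (smod_val sK)); split.
  by apply: dsum_copair_hom => //; apply: smod_val_hom.
exists (fun z => (V z, vsproj (lker V) (z - U (V z)))) => [[x y]|z].
  have Vy : V (smod_val sK y) = 0 by apply/eqP; rewrite -memv_ker smod_val_in.
  rewrite dsum_copairE linearD /= VU Vy addr0 addrAC subrr add0r.
  by congr pair; apply: (smod_valK (sU := sK)).
rewrite dsum_copairE /=.
have -> : smod_val sK (vsproj (lker V) (z - U (V z))) = z - U (V z).
  apply: (smod_projK sK).
  by rewrite memv_ker linearB /= VU subrr.
by rewrite addrC subrK.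
Qed.

Lemma in_add_retract M X (hX : in_add M X) : exists n (u : 'Hom(X, dpow M n)) v,
  [/\ is_hom u, is_hom v & forall x, v (u x) = x].
Proof.
have [n [Y [_ [f [hf [g fK gK]]]]]] := hX; exists n.
exists (f \o @dsum_inl X Y)%VF, (@dsum_fst X Y \o f^-1)%VF.
have fV z : (f^-1)%VF (f z) = z.
  by apply: (can_inj fK); rewrite limg_lfunVK ?memv_img ?memvf.
have Vf z : f ((f^-1)%VF z) = z by rewrite -[z]gK fV.
split; first exact/is_hom_comp/dsum_inl_hom.
  apply: is_hom_comp; first exact: dsum_fst_hom.
  by move=> a x; rewrite -{1}[x]Vf -hf fV.
by move=> x; rewrite !comp_lfunE fV dsum_inlE dsum_fstE.
Qed.

End ModuleTheory.

(** * Modules over a radical square zero algebra *)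

Section RadSquareZeroModules.
Variables (k : fieldType) (Q : quiver).
Local Notation A := (rad_square_zero k Q).
Local Notation idx := (vertex Q + arrow Q)%type.
Local Notation gen := (@rsz_gen k Q).
Implicit Types (i j : idx) (u v : A).

Lemma rsz_coef_inj u v : (forall i, rsz_coef i u = rsz_coef i v) -> u = v.
Proof.
by move=> e; rewrite [u]rsz_gen_expand [v]rsz_gen_expand; apply: eq_bigr => i _; rewrite e.
Qed.

(** [None] is the zero product: either the paths do not compose, or both are arrows and their
    product lies in [J^2]. *)
Definition path_prod i j : option idx :=
  match i, j with
  | inl v, inl w => if v == w then Some i else None
  | inl v, inr x => if v == source x then Some j else None
  | inr x, inl w => if target x == w then Some i else None
  | inr _, inr _ => None
  end.

Lemma rsz_coef_vv (v w : vertex Q) : rsz_coef (inl v) (gen (inl w)) = (v == w)%:R.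
Proof. exact: rsz_coef_gen. Qed.

Lemma rsz_coef_va (v : vertex Q) x : rsz_coef (inl v) (gen (inr x)) = 0.
Proof. exact: rsz_coef_gen. Qed.

Lemma rsz_coef_av x (v : vertex Q) : rsz_coef (inr x) (gen (inl v)) = 0.
Proof. exact: rsz_coef_gen. Qed.

Lemma rsz_coef_aa x y : rsz_coef (inr x) (gen (inr y)) = (x == y)%:R.
Proof. exact: rsz_coef_gen. Qed.

Let coefE := (rsz_coef_vv, rsz_coef_va, rsz_coef_av, rsz_coef_aa).

Lemma rsz_genM i j : gen i * gen j = oapp gen 0 (path_prod i j).
Proof.
apply: rsz_coef_inj => -[w|x]; case: i j => [v1|x1] [v2|x2] /=;
  rewrite ?rsz_coef_vertexM ?rsz_coef_arrowM !coefE ?(mulr0, mul0r, addr0, add0r).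
- have [<-|ne] := eqVneq v1 v2; rewrite /= ?linear0 ?coefE.
    by rewrite -natrM mulnb andbb.
  by case: eqP => [->|_]; rewrite ?(negPf ne) ?mulr0 ?mul0r.
- by case: ifP; rewrite /= ?linear0 ?coefE.
- by case: ifP; rewrite /= ?linear0 ?coefE.
- by rewrite linear0.
- by case: ifP; rewrite /= ?linear0 ?coefE.
- have [->|ne] := eqVneq v1 (source x2); rewrite /= ?linear0 ?coefE.
    by case: (x =P x2) => [->|]; rewrite ?eqxx ?mulr0 ?mul1r.
  by case: (x =P x2) => [->|]; rewrite ?mulr0 // eq_sym (negPf ne) mul0r.
- have [<-|ne] := eqVneq (target x1) v2; rewrite /= ?linear0 ?coefE.
    by case: (x =P x1) => [->|]; rewrite ?eqxx ?mul0r ?mul1r.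
  by case: (x =P x1) => [->|]; rewrite ?mul0r // (negPf ne) mulr0.
- by rewrite linear0.
Qed.

Lemma rsz_sum_vertices : \sum_v gen (inl v) = 1.
Proof.
apply: rsz_coef_inj => -[w|x]; rewrite linear_sum.
  rewrite rsz_coef_vertex1 (bigD1 w) //= big1 ?coefE ?eqxx ?addr0 // => v ne.
  by rewrite coefE eq_sym (negPf ne).
by rewrite rsz_coef_arrow1 big1 // => v _ /=; rewrite coefE.
Qed.

Lemma rsz_linear_ind (P : A -> Prop) :
  P 0 -> (forall c u v, P u -> P v -> P (c *: u + v)) ->
  (forall i, P (gen i)) -> forall u, P u.
Proof.
move=> P0 PL Pg u; rewrite [u]rsz_gen_expand.
apply: (big_ind P) => // [x y Px Py|i _]; first by rewrite -[x]scale1r; apply: PL.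
by rewrite -[_ *: _]addr0; apply: PL.
Qed.

Lemma hom_at_gen (M N : rmod A) (f : 'Hom(M, N)) x :
  (forall i, f (ract M (gen i) x) = ract N (gen i) (f x)) ->
  forall u, f (ract M u x) = ract N u (f x).
Proof.
move=> h; apply: rsz_linear_ind => // [|c u v eu ev].
  by rewrite !linear0 !zero_lfunE linear0.
by rewrite !linearP /= !add_lfunE !scale_lfunE linearP /= eu ev.
Qed.

Lemma is_hom_gen (M N : rmod A) (f : 'Hom(M, N)) :
  (forall i x, f (ract M (gen i) x) = ract N (gen i) (f x)) -> is_hom f.
Proof. by move=> h a x; apply: hom_at_gen. Qed.

Lemma hom_mod_gen (M N : rmod A) (U : {vspace N}) (t : 'Hom(M, N)) :
  (forall i x, t (ract M (gen i) x) - ract N (gen i) (t x) \in U) -> hom_mod U t.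
Proof.
move=> h a x; elim/rsz_linear_ind: a => // [|c u v eu ev].
  by rewrite !linear0 !zero_lfunE linear0 subrr mem0v.
rewrite !linearP /= !add_lfunE !scale_lfunE linearP /= opprD addrACA.
by rewrite -scalerBr memvD ?memvZ.
Qed.

Section Builder.
Variables (V : vectType k) (o : idx -> 'End(V)).
Hypothesis o_sum : forall x, \sum_v o (inl v) x = x.
Hypothesis oM : forall i j x, o j (o i x) = oapp (o^~ x) 0 (path_prod i j).

(** A module is determined by operators for the short paths that obey the multiplication table; [oM]
    applies [o i] before [o j] because the action is on the right. *)
Definition rsz_act (u : A) : 'End(V) := \sum_i rsz_coef i u *: o i.

Lemma rsz_act_linear : linear rsz_act.
Proof.
move=> c u v; rewrite /rsz_act scaler_sumr -big_split; apply: eq_bigr => i _ /=.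
by rewrite linearP scalerDl scalerA.
Qed.

HB.instance Definition _ :=
  GRing.isLinear.Build k A 'End(V) _ rsz_act rsz_act_linear.

Lemma rsz_act_gen i : rsz_act (gen i) = o i.
Proof.
rewrite /rsz_act (bigD1 i) //= big1 => [|j ne].
  by rewrite rsz_coef_gen eqxx scale1r addr0.
by rewrite rsz_coef_gen (negPf ne) scale0r.
Qed.

Lemma rsz_act1 : rsz_act 1 = \1%VF.
Proof.
apply/lfunP => x; rewrite -rsz_sum_vertices linear_sum sum_lfunE id_lfunE.
by rewrite -[RHS]o_sum; apply: eq_bigr => v _ /=; rewrite rsz_act_gen.
Qed.

Lemma rsz_actM u v : rsz_act (u * v) = (rsz_act v \o rsz_act u)%VF.
Proof.
apply/lfunP => x; rewrite comp_lfunE; elim/rsz_linear_ind: u => [|c u u' eu eu'|i].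
- by rewrite mul0r linear0 !zero_lfunE linear0.
- rewrite mulrDl -scalerAl !linearP /= !add_lfunE !scale_lfunE linearP /=.
  by congr (_ *: _ + _).
elim/rsz_linear_ind: v => [|c u u' eu eu'|j].
- by rewrite mulr0 linear0 !zero_lfunE.
- rewrite mulrDr -scalerAr !linearP /= !add_lfunE !scale_lfunE.
  by congr (_ *: _ + _).
rewrite rsz_genM !rsz_act_gen oM; case: path_prod => [l|] /=.
  by rewrite rsz_act_gen.
by rewrite linear0 zero_lfunE.
Qed.

Definition rsz_mod : rmod A := RMod rsz_act1 rsz_actM.

Lemma ract_rsz_mod i x : ract rsz_mod (gen i) x = o i x.
Proof. by rewrite /= rsz_act_gen. Qed.

End Builder.

Section SimpleModule.
Variable v : vertex Q.

Definition simple_op (i : idx) : 'End(k^o) := if i == inl v then \1%VF else 0.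

Lemma simple_op_sum x : \sum_w simple_op (inl w) x = x.
Proof.
rewrite (bigD1 v) //= big1 /simple_op => [|w ne].
  by rewrite eqxx id_lfunE addr0.
by rewrite (inj_eq inl_inj) (negPf ne) zero_lfunE.
Qed.

Lemma simple_opM i j x :
  simple_op j (simple_op i x) = oapp (simple_op^~ x) 0 (path_prod i j).
Proof.
rewrite /simple_op; case: i j => [w|y] [w'|y'] /=;
  rewrite ?zero_lfunE ?linear0 ?(inj_eq inl_inj) //.
- have [<-|ne] /= := eqVneq w w'; rewrite ?(inj_eq inl_inj).
    by case: eqP => _; rewrite ?id_lfunE ?zero_lfunE.
  case: (w =P v) => [wv|_]; last by rewrite zero_lfunE linear0.
  by rewrite id_lfunE -wv eq_sym (negPf ne) zero_lfunE.
- by case: ifP => //= _; rewrite zero_lfunE.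
- by case: ifP => //= _; rewrite zero_lfunE.
Qed.

Definition simple_at : rmod A := rsz_mod simple_op_sum simple_opM.

Lemma simple_at_simple : simple_module simple_at.
Proof.
have dim1 : \dim (fullv : {vspace simple_at}) = 1%N by rewrite dimvf.
split=> [e|U _]; first by move: dim1; rewrite e dimv0.
have := dimvS (subvf U); rewrite dim1; case E: (\dim U) => [|[|n]] // _.
  by left; apply/eqP; rewrite -dimv_eq0 E.
by right; apply/eqP; rewrite eqEdim subvf E dim1.
Qed.

End SimpleModule.

End RadSquareZeroModules.

(** * Modules over the quiver algebra as representations *)

(* The trivial paths, and the arrows [1 -> 2], [2 -> 1], [2 -> 3], [3 -> 2]. *)
Inductive gen3 := E1 | E2 | E3 | Ga | Gb | Gc | Gd.

Local Notation idx3 := (vertex quiver3 + arrow quiver3)%type.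

Definition gen3_idx (i : gen3) : idx3 :=
  match i with
  | E1 => inl (inord 0) | E2 => inl (inord 1) | E3 => inl (inord 2)
  | Ga => inr (inord 0) | Gb => inr (inord 1)
  | Gc => inr (inord 2) | Gd => inr (inord 3)
  end.

Definition idx_gen3 (i : idx3) : gen3 :=
  match i with
  | inl v => match val (v : 'I_3) with 0 => E1 | 1 => E2 | _ => E3 end
  | inr x => match val (x : 'I_4) with 0 => Ga | 1 => Gb | 2 => Gc | _ => Gd end
  end%N.

(** The multiplication table on a plain inductive type, so that products of generators reduce by
    case analysis, without ordinals. *)
Definition gen3_prod (i j : gen3) : option gen3 :=
  match i, j with
  | E1, E1 => Some E1 | E2, E2 => Some E2 | E3, E3 => Some E3
  | E1, Ga | Ga, E2 => Some Ga | E2, Gb | Gb, E1 => Some Gb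
  | E2, Gc | Gc, E3 => Some Gc | E3, Gd | Gd, E2 => Some Gd
  | _, _ => None
  end.

Lemma gen3_idxK : cancel gen3_idx idx_gen3.
Proof. by case; rewrite /idx_gen3 /= inordK. Qed.

Lemma idx_gen3K : cancel idx_gen3 gen3_idx.
Proof.
by move=> [[[|[|[|//]]] h]|[[|[|[|[|//]]]] h]] /=; congr (_ _); apply: val_inj;
  rewrite /= inordK.
Qed.

Lemma path_prod_gen3 i j :
  path_prod (gen3_idx i) (gen3_idx j) = omap gen3_idx (gen3_prod i j).
Proof.
have e (m n : nat) : (m < 3)%N -> (n < 3)%N -> ((inord m : 'I_3) == inord n) = (m == n).
  by move=> hm hn; rewrite -val_eqE /= !inordK.
have s i' : source (i' : arrow quiver3) = tnth [tuple inord 0; inord 1; inord 1; inord 2] i' by [].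
have t i' : target (i' : arrow quiver3) = tnth [tuple inord 1; inord 0; inord 2; inord 1] i' by [].
by case: i j => [] [] //=; rewrite ?s ?t ?(tnth_nth ord0) /= ?inordK //= e.
Qed.

Lemma sum_vertex3 (V : zmodType) (F : vertex quiver3 -> V) :
  \sum_v F v = F (inord 0) + F (inord 1) + F (inord 2).
Proof.
rewrite (big_ord_recl 2) (big_ord_recl 1) (big_ord_recl 0) big_ord0 addr0 addrA.
by congr (F _ + F _ + F _); apply: val_inj; rewrite /= inordK.
Qed.

Section Representations.
Variable k : fieldType.
Local Notation A := (rad_square_zero k quiver3).
Implicit Types M N X Y : rmod A.

Definition op M (i : gen3) : 'End(M) := ract M (rsz_gen k (gen3_idx i)).

Lemma opM M i j x : op M j (op M i x) = oapp ((op M)^~ x) 0 (gen3_prod i j).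
Proof.
rewrite /op -ractA rsz_genM path_prod_gen3; case: gen3_prod => //=.
by rewrite linear0 zero_lfunE.
Qed.

Lemma op_sum M x : x = op M E1 x + op M E2 x + op M E3 x.
Proof.
rewrite /op -!add_lfunE -!linearD -(sum_vertex3 (fun v => rsz_gen k (inl v))).
by rewrite rsz_sum_vertices ract_mul1.
Qed.

Lemma hom_op M N (f : 'Hom(M, N)) i x : is_hom f -> f (op M i x) = op N i (f x).
Proof. exact. Qed.

Lemma is_homP3 M N (f : 'Hom(M, N)) :
  (forall i x, f (op M i x) = op N i (f x)) -> is_hom f.
Proof. by move=> h; apply: is_hom_gen => i x; rewrite -[i]idx_gen3K h. Qed.

Lemma hom_onP3 M N (K : {vspace M}) (f : 'Hom(M, N)) :
  (forall i x, x \in K -> f (op M i x) = op N i (f x)) -> hom_on K f.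
Proof.
move=> h a x xK; apply: hom_at_gen => i.
by rewrite -[i]idx_gen3K; apply: (h (idx_gen3 i)).
Qed.

Lemma hom_modP3 M N (U : {vspace N}) (t : 'Hom(M, N)) :
  (forall i x, t (op M i x) - op N i (t x) \in U) -> hom_mod U t.
Proof.
by move=> h; apply: hom_mod_gen => i x; rewrite -[i]idx_gen3K; apply: h.
Qed.

Section FromRepresentation.
Variables (V1 V2 V3 : vectType k).
Variables (fa : 'Hom(V1, V2)) (fb : 'Hom(V2, V1)) (fc : 'Hom(V2, V3)) (fd : 'Hom(V3, V2)).
Local Notation V := (V1 * V2 * V3)%type.

Definition rep_fun (i : gen3) (x : V) : V :=
  match i with
  | E1 => (x.1.1, 0, 0) | E2 => (0, x.1.2, 0) | E3 => (0, 0, x.2)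
  | Ga => (0, fa x.1.1, 0) | Gb => (fb x.1.2, 0, 0)
  | Gc => (0, 0, fc x.1.2) | Gd => (0, fd x.2, 0)
  end.

Lemma rep_fun_linear i : linear (rep_fun i).
Proof.
by move=> t x y; case: i => /=; apply: injective_projections => //=;
  try apply: injective_projections => //=; rewrite ?linearP ?scaler0 ?addr0.
Qed.

Definition rep_op (i : idx3) : 'End(V) := linfun (rep_fun (idx_gen3 i)).

Lemma rep_opE i x : rep_op (gen3_idx i) x = rep_fun i x.
Proof. by rewrite /rep_op linfunE ?gen3_idxK //; apply: rep_fun_linear. Qed.

(** One equation for each of the six paths of length two. *)
Definition rep_null : Prop :=
  [/\ forall x, fb (fa x) = 0, forall x, fc (fa x) = 0, forall x, fb (fd x) = 0,
      forall x, fc (fd x) = 0 & (forall x, fa (fb x) = 0) /\ (forall x, fd (fc x) = 0)].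

Hypothesis f_null : rep_null.

Lemma rep_op_sum x : \sum_v rep_op (inl v) x = x.
Proof.
rewrite sum_vertex3 (rep_opE E1) (rep_opE E2) (rep_opE E3) /=.
by case: x => [[x1 x2] x3]; apply: injective_projections => /=;
  try apply: injective_projections => /=; rewrite ?addr0 ?add0r.
Qed.

Lemma rep_opM i j x : rep_op j (rep_op i x) = oapp (rep_op^~ x) 0 (path_prod i j).
Proof.
have [ba ca bd cd [ab dc]] := f_null.
rewrite -[i]idx_gen3K -[j]idx_gen3K path_prod_gen3 !rep_opE.
have -> o : oapp (rep_op^~ x) 0 (omap gen3_idx o) = oapp (rep_fun^~ x) 0 o.
  by case: o => //= l; rewrite rep_opE.
by case: (idx_gen3 i); case: (idx_gen3 j); rewrite /= ?linear0
  ?ba ?ca ?bd ?cd ?ab ?dc.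
Qed.

Definition rep_mod : rmod A := rsz_mod rep_op_sum rep_opM.

Lemma op_rep_mod i x : op rep_mod i x = rep_fun i x.
Proof. by rewrite /op ract_rsz_mod rep_opE. Qed.

End FromRepresentation.
End Representations.

Section LinearCombinations.
Variables (k : fieldType) (U V : vectType k).

Lemma linear_comb3 (p q r : U -> k^o) (u v w : V) :
  linear p -> linear q -> linear r -> linear (fun x => p x *: u + q x *: v + r x *: w).
Proof.
move=> hp hq hr t x y; rewrite hp hq hr !scalerDl -!scalerA !scalerDr.
by rewrite (addrACA (t *: (p x *: u))) (addrACA (_ + _)).

Qed.

Lemma linear_comb4 (p q r s : U -> k^o) (u v w z : V) :
  linear p -> linear q -> linear r -> linear s ->
  linear (fun x => p x *: u + q x *: v + r x *: w + s x *: z).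
Proof.
move=> hp hq hr hs t x y; rewrite (linear_comb3 u v w hp hq hr) hs.
by rewrite scalerDl -scalerA !scalerDr addrACA.
Qed.

End LinearCombinations.

(** * The four summands of the tilting module, with the homomorphisms from and to them *)

Section Modules.
Variable k : fieldType.
Local Notation A := (rad_square_zero k quiver3).
Implicit Types X Y : rmod A.
Local Notation K := (k^o).
Local Notation K2 := (k^o * k^o)%type.

Lemma mid1_linear : linear (fun x : (K * K2 * K)%type => x.1.2.1).
Proof. by move=> c [[s [t r]] u] [[s' [t' r']] u']. Qed.

Lemma mid2_linear : linear (fun x : (K * K2 * K)%type => x.1.2.2).
Proof. by move=> c [[s [t r]] u] [[s' [t' r']] u']. Qed.

Definition inl_K2 : 'Hom(K, K2) := linfun (fun s => (s, 0)).
Definition inr_K2 : 'Hom(K, K2) := linfun (fun s => (0, s)).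
Definition fst_K2 : 'Hom(K2, K) := linfun fst.
Definition snd_K2 : 'Hom(K2, K) := linfun snd.

Lemma inl_K2E s : inl_K2 s = (s, 0).
Proof. by rewrite linfunE // => c u v; apply: injective_projections; rewrite /= ?scaler0 ?addr0. Qed.

Lemma inr_K2E s : inr_K2 s = (0, s).
Proof. by rewrite linfunE // => c u v; apply: injective_projections; rewrite /= ?scaler0 ?addr0. Qed.

Lemma fst_K2E s : fst_K2 s = s.1. Proof. by rewrite linfunE. Qed.
Lemma snd_K2E s : snd_K2 s = s.2. Proof. by rewrite linfunE. Qed.

Lemma P2_null : rep_null (0 : 'Hom(K, K)) \1%VF \1%VF (0 : 'Hom(K, K)).
Proof. by split; last split; move=> x; rewrite !lfun_simp. Qed.

Lemma I2_null : rep_null \1%VF (0 : 'Hom(K, K)) (0 : 'Hom(K, K)) \1%VF.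
Proof. by split; last split; move=> x; rewrite !lfun_simp. Qed.

Lemma P13_null : rep_null inl_K2 0 0 inr_K2.
Proof. by split; last split; move=> x; rewrite !zero_lfunE ?linear0. Qed.

Lemma I13_null : rep_null 0 fst_K2 snd_K2 0.
Proof. by split; last split; move=> x; rewrite !zero_lfunE ?linear0. Qed.

(* [P2] and [I2] are the projective cover and the injective hull of the simple at the
   middle vertex; [P13 = P1 (+) P3] and [I13 = I1 (+) I3]. *)
Definition P2 : rmod A := rep_mod P2_null.
Definition I2 : rmod A := rep_mod I2_null.
Definition P13 : rmod A := rep_mod P13_null.
Definition I13 : rmod A := rep_mod I13_null.

Lemma op_P2 i (x : P2) : op P2 i x =
  match i with
  | E1 => (x.1.1, 0, 0) | E2 => (0, x.1.2, 0) | E3 => (0, 0, x.2)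
  | Gb => (x.1.2, 0, 0) | Gc => (0, 0, x.1.2) | _ => 0
  end.
Proof. by rewrite op_rep_mod; case: i; rewrite /= ?id_lfunE ?zero_lfunE. Qed.

Lemma op_I2 i (x : I2) : op I2 i x =
  match i with
  | E1 => (x.1.1, 0, 0) | E2 => (0, x.1.2, 0) | E3 => (0, 0, x.2)
  | Ga => (0, x.1.1, 0) | Gd => (0, x.2, 0) | _ => 0
  end.
Proof. by rewrite op_rep_mod; case: i; rewrite /= ?id_lfunE ?zero_lfunE. Qed.

Lemma op_P13 i (x : P13) : op P13 i x =
  match i with
  | E1 => (x.1.1, 0, 0) | E2 => (0, x.1.2, 0) | E3 => (0, 0, x.2)
  | Ga => (0, (x.1.1, 0), 0) | Gd => (0, (0, x.2), 0) | _ => 0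
  end.
Proof. by rewrite op_rep_mod; case: i; rewrite /= ?inl_K2E ?inr_K2E ?zero_lfunE. Qed.

Lemma op_I13 i (x : I13) : op I13 i x =
  match i with
  | E1 => (x.1.1, 0, 0) | E2 => (0, x.1.2, 0) | E3 => (0, 0, x.2)
  | Gb => (x.1.2.1, 0, 0) | Gc => (0, 0, x.1.2.2) | _ => 0
  end.
Proof. by rewrite op_rep_mod; case: i; rewrite /= ?fst_K2E ?snd_K2E ?zero_lfunE. Qed.

Ltac hom_out := rewrite !linearD !linearZ /= !opM /= ?linear0 ?scale0r ?scaler0 ?addr0 ?add0r.

(** The isomorphism [Hom(P2, X) = X e2]: the generator goes to [op X E2 v]. Cutting down by [E2]
    allows [v] to be any vector, in particular a basis vector of [X]. *)
Definition from_P2 X (v : X) : 'Hom(P2, X) :=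
  linfun (fun x : P2 => x.1.1 *: op X Gb v + x.1.2 *: op X E2 v + x.2 *: op X Gc v).

Lemma from_P2E X (v : X) (x : P2) :
  from_P2 v x = x.1.1 *: op X Gb v + x.1.2 *: op X E2 v + x.2 *: op X Gc v.
Proof. by rewrite linfunE //; apply: linear_comb3. Qed.

Lemma from_P2_hom X (v : X) : is_hom (from_P2 v).
Proof. by apply: is_homP3 => i x; rewrite op_P2 !from_P2E; case: i => /=; hom_out. Qed.

Definition from_P13 X (y z : X) : 'Hom(P13, X) :=
  linfun (fun x : P13 => x.1.1 *: op X E1 y + x.1.2.1 *: op X Ga y +
                        x.1.2.2 *: op X Gd z + x.2 *: op X E3 z).

Lemma from_P13E X (y z : X) (x : P13) : from_P13 y z x =
  x.1.1 *: op X E1 y + x.1.2.1 *: op X Ga y + x.1.2.2 *: op X Gd z + x.2 *: op X E3 z.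
Proof.
rewrite linfunE //; apply: linear_comb4; first by [].
- exact: mid1_linear.
- exact: mid2_linear.
by [].
Qed.

Lemma from_P13_hom X (y z : X) : is_hom (from_P13 y z).
Proof. by apply: is_homP3 => i x; rewrite op_P13 !from_P13E; case: i => /=; hom_out. Qed.

(** [I2] is [P1 (+) P3] with the two socles identified, whence the condition [a y = d z] in
    [from_I2_hom]. *)
Definition from_I2 X (y z : X) : 'Hom(I2, X) :=
  linfun (fun x : I2 => x.1.1 *: op X E1 y + x.1.2 *: op X Ga y + x.2 *: op X E3 z).

Lemma from_I2E X (y z : X) (x : I2) : from_I2 y z x =
  x.1.1 *: op X E1 y + x.1.2 *: op X Ga y + x.2 *: op X E3 z.
Proof. by rewrite linfunE //; apply: linear_comb3. Qed.

Lemma from_I2_hom X (y z : X) : op X Ga y = op X Gd z -> is_hom (from_I2 y z).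
Proof.
by move=> e; apply: is_homP3 => i x; rewrite op_I2 !from_I2E; case: i => /=; hom_out;
  rewrite ?e.
Qed.

(** [I1] is [P2] modulo the image of [c] and [I3] is [P2] modulo the image of [b], whence the two
    conditions in [from_I13_hom]. *)
Definition from_I13 X (u w : X) : 'Hom(I13, X) :=
  linfun (fun x : I13 => x.1.1 *: op X Gb u + x.1.2.1 *: op X E2 u +
                        x.1.2.2 *: op X E2 w + x.2 *: op X Gc w).

Lemma from_I13E X (u w : X) (x : I13) : from_I13 u w x =
  x.1.1 *: op X Gb u + x.1.2.1 *: op X E2 u + x.1.2.2 *: op X E2 w + x.2 *: op X Gc w.
Proof.
rewrite linfunE //; apply: linear_comb4; first by [].
- exact: mid1_linear.
- exact: mid2_linear.
by [].
Qed.

Lemma from_I13_hom X (u w : X) :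
  op X Gc u = 0 -> op X Gb w = 0 -> is_hom (from_I13 u w).
Proof.
by move=> eu ew; apply: is_homP3 => i x; rewrite op_I13 !from_I13E; case: i => /=; hom_out;
  rewrite ?eu ?ew ?scaler0 ?addr0 ?add0r.
Qed.

Ltac lin_in := let c := fresh in let u := fresh in let v := fresh in
  move=> c u v; rewrite !linearP.
Ltac hom_in := rewrite /= !opM /= ?linear0.

(** [Hom(X, I2)] is the linear dual of [X e2]: the middle component is a free functional and forces
    the outer ones. [to_I13] is the analogue at the outer vertices. *)
Definition to_I2 X (f : 'Hom(X, K)) : 'Hom(X, I2) :=
  linfun (fun x => (f (op X Ga x), f (op X E2 x), f (op X Gd x)) : I2).

Lemma to_I2E X (f : 'Hom(X, K)) x :
  to_I2 f x = (f (op X Ga x), f (op X E2 x), f (op X Gd x)).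
Proof. by rewrite linfunE //; lin_in. Qed.

Lemma to_I2_hom X (f : 'Hom(X, K)) : is_hom (to_I2 f).
Proof. by apply: is_homP3 => i x; rewrite op_I2 !to_I2E; case: i; hom_in. Qed.

Definition to_I13 X (f g : 'Hom(X, K)) : 'Hom(X, I13) :=
  linfun (fun x => (f (op X E1 x), (f (op X Gb x), g (op X Gc x)), g (op X E3 x)) : I13).

Lemma to_I13E X (f g : 'Hom(X, K)) x :
  to_I13 f g x = (f (op X E1 x), (f (op X Gb x), g (op X Gc x)), g (op X E3 x)).
Proof. by rewrite linfunE //; lin_in. Qed.

Lemma to_I13_hom X (f g : 'Hom(X, K)) : is_hom (to_I13 f g).
Proof. by apply: is_homP3 => i x; rewrite op_I13 !to_I13E; case: i; hom_in. Qed.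

Definition to_P2 X (f g h : 'Hom(X, K)) : 'Hom(X, P2) :=
  linfun (fun x => (f (op X E1 x), g (op X E2 x), h (op X E3 x)) : P2).

Lemma to_P2E X (f g h : 'Hom(X, K)) x :
  to_P2 f g h x = (f (op X E1 x), g (op X E2 x), h (op X E3 x)).
Proof. by rewrite linfunE //; lin_in. Qed.

Lemma to_P2_hom X (f g h : 'Hom(X, K)) :
  (forall x, f (op X Gb x) = g (op X E2 x)) -> (forall x, h (op X Gc x) = g (op X E2 x)) ->
  (forall x, g (op X Ga x) = 0) -> (forall x, g (op X Gd x) = 0) ->
  is_hom (to_P2 f g h).
Proof.
move=> ef eh ga gd; apply: is_homP3 => i x; rewrite op_P2 !to_P2E.
by case: i; hom_in; rewrite ?ef ?eh ?ga ?gd.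
Qed.

Definition to_P13 X (f g : 'Hom(X, K)) : 'Hom(X, P13) :=
  linfun (fun x => (f (op X Ga x), (f (op X E2 x), g (op X E2 x)), g (op X Gd x)) : P13).

Lemma to_P13E X (f g : 'Hom(X, K)) x :
  to_P13 f g x = (f (op X Ga x), (f (op X E2 x), g (op X E2 x)), g (op X Gd x)).
Proof. by rewrite linfunE //; lin_in. Qed.

Lemma to_P13_hom X (f g : 'Hom(X, K)) :
  (forall x, f (op X Gd x) = 0) -> (forall x, g (op X Ga x) = 0) -> is_hom (to_P13 f g).
Proof.
move=> ef eg; apply: is_homP3 => i x; rewrite op_P13 !to_P13E.
by case: i; hom_in; rewrite ?ef ?eg.
Qed.

Lemma P2_gen (x : P2) : x = from_P2 ((0, 1, 0) : P2) x.
Proof.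
rewrite from_P2E !op_P2; case: x => [[s t] r].
by congr (_, _, _); rewrite /= ?scaler0 ?addr0 ?add0r ?[_ *: _]mulr1.
Qed.

Lemma P13_gen (x : P13) : x = from_P13 ((1, 0, 0) : P13) ((0, 0, 1) : P13) x.
Proof.
rewrite from_P13E !op_P13; case: x => [[s [t t']] r].
by congr (_, (_, _), _); rewrite /= ?scaler0 ?addr0 ?add0r ?[_ *: _]mulr1.
Qed.

Lemma comp_from_P2 X Y (g : 'Hom(X, Y)) v :
  is_hom g -> (g \o from_P2 v)%VF = from_P2 (g v).
Proof.
move=> hg; apply/lfunP => x; rewrite comp_lfunE !from_P2E !linearD !linearZ /=.
by congr (_ *: _ + _ *: _ + _ *: _); apply: hom_op.
Qed.

Lemma comp_from_P13 X Y (g : 'Hom(X, Y)) y z :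
  is_hom g -> (g \o from_P13 y z)%VF = from_P13 (g y) (g z).
Proof.
move=> hg; apply/lfunP => x; rewrite comp_lfunE !from_P13E !linearD !linearZ /=.
by congr (_ *: _ + _ *: _ + _ *: _ + _ *: _); apply: hom_op.
Qed.

(** A homomorphism from [P2] is determined by the image of the generator, and that image may be
    lifted arbitrarily along [g]. *)
Lemma P2_projective : projective P2.
Proof.
move=> M N g f hg og hf; pose p : P2 := (0, 1, 0).
exists (from_P2 ((g^-1)%VF (f p))); split; first exact: from_P2_hom.
rewrite comp_from_P2 // limg_full_inv // -comp_from_P2 //.
by apply/lfunP => x; rewrite comp_lfunE; congr (f _); rewrite -P2_gen.
Qed.

Lemma P13_projective : projective P13.
Proof.
move=> M N g f hg og hf; pose p : P13 := (1, 0, 0); pose q : P13 := (0, 0, 1).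
exists (from_P13 ((g^-1)%VF (f p)) ((g^-1)%VF (f q))); split; first exact: from_P13_hom.
rewrite comp_from_P13 // !limg_full_inv // -comp_from_P13 //.
by apply/lfunP => x; rewrite comp_lfunE; congr (f _); rewrite -P13_gen.
Qed.

End Modules.

(** * The balance conditions *)

Section Functionals.
Variables (k : fieldType) (V : vectType k).

Definition coord_fun n (b : n.-tuple V) i : 'Hom(V, k^o) := linfun (coord b i : V -> k^o).

Lemma coord_funE n (b : n.-tuple V) i x : coord_fun b i x = coord b i x.
Proof. by rewrite linfunE // => c u v; rewrite linearP. Qed.

(** Some coordinate of the component of [x] outside [U] is nonzero. *)
Lemma separating_functional (U : {vspace V}) x :
  x \notin U -> exists f : 'Hom(V, k^o), f x != 0 /\ (U <= lker f)%VS.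
Proof.
move=> xU; pose q : 'End(V) := (\1 - projv U)%VF.
have qE y : q y = y - projv U y by rewrite !lfun_simp.
pose b := vbasis (fullv : {vspace V}).
have [i ci] : exists i, coord b i (q x) != 0.
  apply/existsP; apply: contraR xU => /existsPn c0.
  have : q x = 0.
    rewrite (coord_vbasis (memvf (q x))) big1 // => i _.
    by have /negPn/eqP -> := c0 i; rewrite scale0r.
  by rewrite qE => /eqP; rewrite subr_eq0 => /eqP ->; apply: memv_proj.
exists (coord_fun b i \o q)%VF; split; first by rewrite comp_lfunE coord_funE.
apply/subvP => y yU; rewrite memv_ker comp_lfunE qE projv_id // subrr.
by rewrite linear0.
Qed.

End Functionals.

Section Balanced.
Variable k : fieldType.
Local Notation A := (rad_square_zero k quiver3).
Implicit Types X Y M N P : rmod A.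
Local Notation P2 := (P2 k).
Local Notation P13 := (P13 k).
Local Notation I2 := (I2 k).
Local Notation I13 := (I13 k).

(** The hypothesis [op X E1 x = x] places [x] at vertex 1. Only the inclusion of the kernel in the
    image is stated; the other one holds in every module, as composites of arrows vanish. *)
Definition balanced1 X := forall x, op X E1 x = x -> op X Ga x = 0 -> exists y, x = op X Gb y.
Definition balanced2 X := forall x, op X E2 x = x -> op X Gb x = 0 -> op X Gc x = 0 ->
  exists y z, x = op X Ga y + op X Gd z.
Definition balanced3 X := forall x, op X E3 x = x -> op X Gd x = 0 -> exists y, x = op X Gc y.
Definition balanced X := [/\ balanced1 X, balanced2 X & balanced3 X].

Lemma balanced_retract X Y (u : 'Hom(X, Y)) (v : 'Hom(Y, X)) :
  is_hom u -> is_hom v -> (forall x, v (u x) = x) -> balanced Y -> balanced X.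
Proof.
move=> hu hv vu [b1 b2 b3]; split=> [x ex ax|x ex bx cx|x ex dx].
- have [||y ey] := b1 (u x); rewrite -?(hom_op _ _ hu) ?ex ?ax ?linear0 //.
  by exists (v y); rewrite -(hom_op _ _ hv) -ey vu.
- have [|||y [z eyz]] := b2 (u x); rewrite -?(hom_op _ _ hu) ?ex ?bx ?cx ?linear0 //.
  by exists (v y), (v z); rewrite -!(hom_op _ _ hv) -linearD /= -eyz vu.
- have [||y ey] := b3 (u x); rewrite -?(hom_op _ _ hu) ?ex ?dx ?linear0 //.
  by exists (v y); rewrite -(hom_op _ _ hv) -ey vu.
Qed.

Lemma op_dsum X Y i (x : dsum X Y) : op (dsum X Y) i x = (op X i x.1, op Y i x.2).
Proof. exact: ract_dsum. Qed.

Lemma op_dpow X n i (x : dpow X n) j : op (dpow X n) i x j = op X i (x j).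
Proof. exact: ract_dpow. Qed.

Lemma balanced_dsum X Y : balanced X -> balanced Y -> balanced (dsum X Y).
Proof.
move=> [b1 b2 b3] [c1 c2 c3]; split=> -[x y]; rewrite !op_dsum /=.
- move=> [ex ey] [ax ay]; have [[u ->] [v ->]] := (b1 x ex ax, c1 y ey ay).
  by exists (u, v); rewrite op_dsum.
- move=> [ex ey] [bx by'] [cx cy].
  have [u [w ->]] := b2 x ex bx cx; have [v [z ->]] := c2 y ey by' cy.
  by exists (u, v), (w, z); rewrite !op_dsum.
- move=> [ex ey] [ax ay]; have [[u ->] [v ->]] := (b3 x ex ax, c3 y ey ay).
  by exists (u, v); rewrite op_dsum.
Qed.

Lemma balanced_dpow X n : balanced X -> balanced (dpow X n).
Proof.
have opE i x y : op (dpow X n) i x = y -> forall j, op X i (x j) = y j.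
  by move=> e j; rewrite -op_dpow e.
move=> [b1 b2 b3]; split=> x /opE ex.
- move=> /opE ax; have h j : exists y, x j = op X Gb y.
    by apply: b1; rewrite ?ex // ax ffunE.
  exists [ffun j => projT1 (cid (h j))]; apply/ffunP => j.
  by rewrite op_dpow ffunE; case: cid.
- move=> /opE bx /opE cx; have h j : exists y, x j = op X Ga y.1 + op X Gd y.2.
    have [||| y [z e]] := b2 (x j); rewrite ?ex // ?bx ?cx ?ffunE //.
    by exists (y, z).
  exists [ffun j => (projT1 (cid (h j))).1], [ffun j => (projT1 (cid (h j))).2].
  by apply/ffunP => j; rewrite ffunE !op_dpow !ffunE; case: cid.
- move=> /opE ax; have h j : exists y, x j = op X Gc y.
    by apply: b3; rewrite ?ex // ax ffunE.
  exists [ffun j => projT1 (cid (h j))]; apply/ffunP => j.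
  by rewrite op_dpow ffunE; case: cid.
Qed.

Lemma P2_balanced : balanced P2.
Proof.
split=> -[[s t] r]; rewrite !op_P2 /=.
- by move=> [<- <-] _; exists (0, s, 0); rewrite op_P2.
- by move=> [<- <-] [-> _]; exists 0, 0; rewrite !linear0 addr0.
- by move=> [<- <-] _; exists (0, r, 0); rewrite op_P2.
Qed.

Lemma I2_balanced : balanced I2.
Proof.
split=> -[[s t] r]; rewrite !op_I2 /=.
- by move=> [<- <-] [->]; exists 0; rewrite linear0.
- move=> [<- <-] _ _; exists (t, 0, 0), 0; rewrite linear0 addr0.
  by rewrite op_I2.
- by move=> [<- <-] [->]; exists 0; rewrite linear0.
Qed.

Lemma P13_balanced : balanced P13.
Proof.
split=> -[[s [t t']] r]; rewrite !op_P13 /=.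
- by move=> [<- <- <-] [->]; exists 0; rewrite linear0.
- move=> [<- <-] _ _; exists (t, 0, 0), (0, 0, t'); rewrite !op_P13 /=.
  by congr (_, (_, _), _); rewrite ?addr0 ?add0r.
- by move=> [<- <- <-] [->]; exists 0; rewrite linear0.
Qed.

Lemma I13_balanced : balanced I13.
Proof.
split=> -[[s [t t']] r]; rewrite !op_I13 /=.
- by move=> [<- <- <-] _; exists (0, (s, 0), 0); rewrite op_I13.
- by move=> [<- <-] [->] [->]; exists 0, 0; rewrite !linear0 addr0.
- by move=> [<- <- <-] _; exists (0, (0, r), 0); rewrite op_I13.
Qed.

Definition tilting : rmod A := dsum (dsum P2 P13) (dsum I2 I13).

Lemma in_add_balanced X : in_add tilting X -> balanced X.
Proof.
move=> /in_add_retract[n [u [v [hu hv vu]]]].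
apply: (balanced_retract hu hv vu); apply: balanced_dpow.
apply: balanced_dsum; apply: balanced_dsum.
- exact: P2_balanced.
- exact: P13_balanced.
- exact: I2_balanced.
- exact: I13_balanced.
Qed.

Lemma enough_projectives X : exists P (p : 'Hom(P, X)), proj_epi p.
Proof.
pose b := vbasis (fullv : {vspace X}).
pose f (i : 'I_(\dim (fullv : {vspace X}))) := dsum_copair (from_P2 b`_i) (from_P13 b`_i b`_i).
exists (dpow (dsum P2 P13) (\dim (fullv : {vspace X}))), (dpow_cotuple f); split.
- apply: projective_dpow; apply: projective_dsum.
    exact: P2_projective.
  exact: P13_projective.
- apply: dpow_cotuple_hom => i; apply: dsum_copair_hom.
    exact: from_P2_hom.
  exact: from_P13_hom.
apply: limg_fullP => x.
(* The [i]-th copy of [P2 (+) P13] supplies the three vertex components of the [i]-th basis vector,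
   scaled by the coordinate of [x]. *)
exists [ffun i => ((0, coord b i x, 0), (coord b i x, 0, coord b i x))].
have opx j : op X j x = \sum_i coord b i x *: op X j b`_i.
  rewrite {1}(coord_vbasis (memvf x)) linear_sum; apply: eq_bigr => i _.
  by rewrite linearZ.
rewrite dpow_cotupleE [RHS]op_sum [RHS]addrAC !opx -!big_split.
apply: eq_bigr => i _; rewrite ffunE dsum_copairE from_P2E from_P13E /=.
by rewrite !scale0r !addr0 !add0r addrC.
Qed.

Definition cover_I2 : 'Hom(P13, I2) := from_P13 ((1, 0, 0) : I2) ((0, 0, 1) : I2).

Lemma cover_I2E x : cover_I2 x = (x.1.1, x.1.2.1 + x.1.2.2, x.2).
Proof.
rewrite from_P13E !op_I2 /=; case: x => [[s [t t']] r].
by congr (_, _, _); rewrite /= ?scaler0 ?addr0 ?add0r ?[_ *: _]mulr1.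
Qed.

Lemma cover_I2P : proj_epi cover_I2.
Proof.
split; [exact: P13_projective|exact: from_P13_hom|].
apply: limg_fullP => -[[s t] r]; exists (s, (t, 0), r).
by rewrite cover_I2E /= addr0.
Qed.

Definition cover_I13 : 'Hom(dsum P2 P2, I13) :=
  dsum_copair (from_P2 ((0, (1, 0), 0) : I13)) (from_P2 ((0, (0, 1), 0) : I13)).

Lemma cover_I13E x : cover_I13 x = (x.1.1.1, (x.1.1.2, x.2.1.2), x.2.2).
Proof.
rewrite dsum_copairE !from_P2E !op_I13 /=; case: x => [[[s t] r] [[s' t'] r']].
by congr (_, (_, _), _); rewrite /= ?scaler0 ?addr0 ?add0r ?[_ *: _]mulr1.
Qed.

Lemma cover_I13P : proj_epi cover_I13.
Proof.
split; first by apply: projective_dsum; apply: P2_projective.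
  by apply: dsum_copair_hom; apply: from_P2_hom.
apply: limg_fullP => -[[s [t t']] r]; exists ((s, t, 0), (0, t', r)).
by rewrite cover_I13E.
Qed.

End Balanced.

(** * Extensions of the injective summands, and injective hulls of the projective ones *)

Section Extensions.
Variable k : fieldType.
Local Notation A := (rad_square_zero k quiver3).
Implicit Types X Y M N P : rmod A.
Local Notation P2 := (P2 k).
Local Notation P13 := (P13 k).
Local Notation I2 := (I2 k).
Local Notation I13 := (I13 k).
Local Notation K := (k^o).
Local Notation K2 := (k^o * k^o)%type.

Definition co31 : 'Hom((K * K * K)%type, K) := linfun (fun x => x.1.1).
Definition co32 : 'Hom((K * K * K)%type, K) := linfun (fun x => x.1.2).
Definition co33 : 'Hom((K * K * K)%type, K) := linfun snd.
Definition co41 : 'Hom((K * K2 * K)%type, K) := linfun (fun x => x.1.1).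
Definition co42 : 'Hom((K * K2 * K)%type, K) := linfun (fun x => x.1.2.1).
Definition co43 : 'Hom((K * K2 * K)%type, K) := linfun (fun x => x.1.2.2).
Definition co44 : 'Hom((K * K2 * K)%type, K) := linfun snd.

Lemma co31E x : co31 x = x.1.1. Proof. by rewrite linfunE. Qed.
Lemma co32E x : co32 x = x.1.2. Proof. by rewrite linfunE. Qed.
Lemma co33E x : co33 x = x.2. Proof. by rewrite linfunE. Qed.
Lemma co41E x : co41 x = x.1.1. Proof. by rewrite linfunE. Qed.
Lemma co42E x : co42 x = x.1.2.1. Proof. by rewrite linfunE. Qed.
Lemma co43E x : co43 x = x.1.2.2. Proof. by rewrite linfunE. Qed.
Lemma co44E x : co44 x = x.2. Proof. by rewrite linfunE. Qed.

Lemma op_fix1 X x i : op X E1 x = x ->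
  op X i x = match i with E1 => x | Ga => op X Ga x | _ => 0 end.
Proof. by move=> <-; rewrite opM; case: i => //=; rewrite !opM. Qed.

Lemma op_fix2 X x i : op X E2 x = x ->
  op X i x = match i with E2 => x | Gb => op X Gb x | Gc => op X Gc x | _ => 0 end.
Proof. by move=> <-; rewrite opM; case: i => //=; rewrite !opM. Qed.

Lemma op_fix3 X x i : op X E3 x = x ->
  op X i x = match i with E3 => x | Gd => op X Gd x | _ => 0 end.
Proof. by move=> <-; rewrite opM; case: i => //=; rewrite !opM. Qed.

Definition rank1 (U : vectType k) X (f : 'Hom(U, K)) (x : X) : 'Hom(U, X) := linfun (fun y => f y *: x).

Lemma rank1E (U : vectType k) X (f : 'Hom(U, K)) (x : X) y : rank1 f x y = f y *: x.
Proof.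
rewrite linfunE // => c u v.
by rewrite linearP scalerDl scalerA.
Qed.

(** The kernel is a copy of [S2] spanned by [w], so a homomorphism from it is a vector [h w] at
    vertex 2 killed by [b] and [c]. Since [w] is [a] of one generator of [P13] minus [d] of the
    other, [h] extends exactly when [h w] lies in [im a + im d]. *)
Lemma ext_onto_cover_I2 X : ext_onto (lker (cover_I2 k)) X <-> balanced2 X.
Proof.
have KP y : y \in lker (cover_I2 k) -> [/\ y.1.1 = 0, y.1.2.2 = - y.1.2.1 & y.2 = 0].
  by rewrite memv_ker cover_I2E => /eqP[-> /eqP + ->]; rewrite addrC addr_eq0 => /eqP ->.
pose w : P13 := (0, (1, -1), 0).
have wK : w \in lker (cover_I2 k) by rewrite memv_ker cover_I2E /= subrr.
split=> [E x ex bx cx|b h hh].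
  have [|g [hg eg]] := E (rank1 (co42 : 'Hom(P13, K)) x).
    apply: hom_onP3 => i y /KP[y1 y2 y3].
    rewrite !rank1E linearZ /= (op_fix2 _ ex) !co42E op_P13 y1.
    by case: i; rewrite /= ?bx ?cx ?scaler0 ?scale0r.
  have := eg w wK; rewrite rank1E co42E scale1r => <-.
  have -> : w = op P13 Ga (1, 0, 0) - op P13 Gd (0, 0, 1).
    by rewrite !op_P13 /=; congr (_, (_, _), _); rewrite ?subr0 ?sub0r.
  exists (g (1, 0, 0)), (- g (0, 0, 1)).
  by rewrite linearN linearB /=; congr (_ - _); exact: (hom_op _ _ hg).
have hw i : op X i (h w) = h (op P13 i w) by rewrite hh.
have [||| y [z eyz]] := b (h w); rewrite ?hw ?op_P13 ?linear0 //.
exists (from_P13 y (- z)); split; first exact: from_P13_hom.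
move=> u /KP[u1 u2 u3]; have -> : u = u.1.2.1 *: w.
  case: u u1 u2 u3 => [[s [t t']] r] /= -> -> ->.
  by congr (_, (_, _), _); rewrite ?scaler0 ?[_ *: _]mulr1 ?[_ *: _]mulrN1.
rewrite !linearZ /= eyz from_P13E /= !scale0r add0r addr0 scale1r scaleN1r.
by rewrite [op X Gd _]linearN opprK.
Qed.

(** The kernel is [S3 (+) S1], spanned by [w3], which is [c] of the first generator, and [w1], which
    is [b] of the second. Extending a homomorphism thus means solving [h w3 = c v] and
    [h w1 = b u]. *)
Lemma ext_onto_cover_I13 X :
  ext_onto (lker (cover_I13 k)) X <-> balanced1 X /\ balanced3 X.
Proof.
have KP y : y \in lker (cover_I13 k) -> [/\ y.1.1 = 0, y.2.1.2 = 0 & y.2.2 = 0].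
  by case: y => [[[s t] r] [[s' t'] r']]; rewrite memv_ker cover_I13E => /eqP[-> -> -> ->].
pose w1 : dsum P2 P2 := (0, (1, 0, 0)).
pose w3 : dsum P2 P2 := ((0, 0, 1), 0).
have wK1 : w1 \in lker (cover_I13 k) by rewrite memv_ker cover_I13E.
have wK3 : w3 \in lker (cover_I13 k) by rewrite memv_ker cover_I13E.
split=> [E|[b1 b3] h hh]; first split=> [x ex ax|x ex dx].
- pose f : 'Hom(dsum P2 P2, K) := ((co31 : 'Hom(P2, K)) \o @dsum_snd _ _ P2 P2)%VF.
  have fE z : f z = z.2.1.1 by rewrite comp_lfunE co31E (@dsum_sndE _ _ P2 P2).
  have [|g [hg eg]] := E (rank1 f x).
    apply: hom_onP3 => i y /KP[y1 y2 y3].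
    rewrite !rank1E linearZ /= (op_fix1 _ ex) !fE (op_dsum i y) !op_P2 y2 y3.
    by case: i; rewrite /= ?ax ?scaler0 ?scale0r.
  have := eg w1 wK1; rewrite rank1E fE scale1r => <-.
  have -> : w1 = op (dsum P2 P2) Gb (0, (0, 1, 0)) by rewrite op_dsum linear0 op_P2.
  by exists (g (0, (0, 1, 0))); exact: (hom_op _ _ hg).
- pose f : 'Hom(dsum P2 P2, K) := ((co33 : 'Hom(P2, K)) \o @dsum_fst _ _ P2 P2)%VF.
  have fE z : f z = z.1.2 by rewrite comp_lfunE co33E (@dsum_fstE _ _ P2 P2).
  have [|g [hg eg]] := E (rank1 f x).
    apply: hom_onP3 => i y /KP[y1 y2 y3].
    rewrite !rank1E linearZ /= (op_fix3 _ ex) !fE (op_dsum i y) !op_P2 y1.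
    by case: i; rewrite /= ?dx ?scaler0 ?scale0r.
  have := eg w3 wK3; rewrite rank1E fE scale1r => <-.
  have -> : w3 = op (dsum P2 P2) Gc ((0, 1, 0), 0) by rewrite op_dsum linear0 op_P2.
  by exists (g ((0, 1, 0), 0)); exact: (hom_op _ _ hg).
have hw1 i : op X i (h w1) = h (op (dsum P2 P2) i w1) by rewrite hh.
have hw3 i : op X i (h w3) = h (op (dsum P2 P2) i w3) by rewrite hh.
have [||u eu] := b1 (h w1); rewrite ?hw1 ?op_dsum ?op_P2 ?linear0 //.
have [||v ev] := b3 (h w3); rewrite ?hw3 ?op_dsum ?op_P2 ?linear0 //.
exists (dsum_copair (from_P2 v) (from_P2 u)); split.
  by apply: dsum_copair_hom; apply: from_P2_hom.
move=> y /KP[y1 y2 y3]; have -> : y = y.2.1.1 *: w1 + y.1.2 *: w3.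
  case: y y1 y2 y3 => [[[s t] r] [[s' t'] r']] /= [-> ->] -> ->.
  by congr (_, _, _, (_, _, _)); rewrite /=; rewrite ?scaler0 ?[_ *: _]mulr1 ?addr0 ?add0r.
have gw1 : dsum_copair (from_P2 v) (from_P2 u) w1 = h w1.
  rewrite eu dsum_copairE linear0 add0r from_P2E /=.
  by rewrite !scale0r scale1r !addr0.
have gw3 : dsum_copair (from_P2 v) (from_P2 u) w3 = h w3.
  rewrite ev dsum_copairE linear0 addr0 from_P2E /=.
  by rewrite !scale0r scale1r !add0r.
by rewrite !linearD !linearZ; congr (_ *: _ + _ *: _).
Qed.

(** A partial homomorphism to [I2] amounts to a functional at vertex 2. As [h] is linear on all of
    [M], this functional is already extended, and [to_I2] turns it into a homomorphism. *)
Lemma I2_injective : injective_module I2.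
Proof.
move=> M U sU h hh; exists (to_I2 ((co32 : 'Hom(I2, K)) \o h)%VF).
split; first exact: to_I2_hom.
move=> x xU; have hx i : h (op M i x) = op I2 i (h x) by rewrite hh.
rewrite to_I2E !comp_lfunE !hx !co32E !op_I2 /=.
by case: (h x) => [[s t] r].
Qed.

Lemma I13_injective : injective_module I13.
Proof.
move=> M U sU h hh.
exists (to_I13 ((co41 : 'Hom(I13, K)) \o h)%VF ((co44 : 'Hom(I13, K)) \o h)%VF).
split; first exact: to_I13_hom.
move=> x xU; have hx i : h (op M i x) = op I13 i (h x) by rewrite hh.
rewrite to_I13E !comp_lfunE !hx !co41E !co44E !op_I13 /=.
by case: (h x) => [[s [t t']] r].
Qed.

Definition hull_P2 : 'Hom(P2, I13) := to_I13 (co31 : 'Hom(P2, K)) (co33 : 'Hom(P2, K)).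

Lemma hull_P2E x : hull_P2 x = (x.1.1, (x.1.2, x.1.2), x.2).
Proof. by rewrite to_I13E !co31E !co33E !op_P2. Qed.

Lemma mem_limg_hull_P2 y : (y \in limg hull_P2) = (y.1.2.1 == y.1.2.2).
Proof.
apply/idP/idP => [/memv_imgP[x _ ->]|]; first by rewrite hull_P2E.
case: y => [[s [t t']] r] /= /eqP ->.
have -> : (s, (t', t'), r) = hull_P2 (s, t', r) by rewrite hull_P2E.
by rewrite memv_img ?memvf.
Qed.

Definition hull_P13 : 'Hom(P13, dsum I2 I2) :=
  dsum_pair (to_I2 (co42 : 'Hom(P13, K))) (to_I2 (co43 : 'Hom(P13, K))).

Lemma hull_P13E x : hull_P13 x = (x.1.1, x.1.2.1, 0, (0, x.1.2.2, x.2)).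
Proof. by rewrite dsum_pairE !to_I2E !co42E !co43E !op_P13. Qed.

Lemma mem_limg_hull_P13 y :
  (y \in limg hull_P13) = (y.1.2 == 0) && (y.2.1.1 == 0).
Proof.
apply/idP/idP => [/memv_imgP[x _ ->]|]; first by rewrite hull_P13E /= !eqxx.
case: y => [[[s t] r] [[s' t'] r']] /= /andP[/eqP -> /eqP ->].
have -> : (s, t, 0, (0, t', r')) = hull_P13 (s, (t, t'), r') by rewrite hull_P13E.
by rewrite memv_img ?memvf.
Qed.

End Extensions.

(** * Both Ext conditions for the tilting module amount to balance *)

Section TiltingExtensions.
Variable k : fieldType.
Local Notation A := (rad_square_zero k quiver3).
Implicit Types X Y M N P : rmod A.
Local Notation P2 := (P2 k).
Local Notation P13 := (P13 k).
Local Notation I2 := (I2 k).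
Local Notation I13 := (I13 k).
Local Notation K := (k^o).

Lemma hom_mod_op X Y (U : {vspace Y}) (t : 'Hom(X, Y)) i x :
  hom_mod U t -> t (op X i x) - op Y i (t x) \in U.
Proof. by move=> ht; apply: ht. Qed.

Lemma subr_exchange (V : zmodType) (p1 p2 q1 q2 : V) :
  p1 - q1 = p2 - q2 -> p1 - p2 = q1 - q2.
Proof.
move/(canRL (subrK _)) ->.
by rewrite addrAC [p2 - q2]addrC addrK addrC.
Qed.

(** The difference of the two middle coordinates identifies [I13 / P2] with [S2], so [t] amounts to
    a functional on [V2] that vanishes on [im a + im d]. It lifts to [I13] exactly when it factors
    through [(b, c)]. *)
Lemma lifts_hull_P2 X : lifts_mod X (limg (hull_P2 k)) <-> balanced2 X.
Proof.
split=> [L x ex bx cx|b t ht].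
  have [/memv_addP[y1 y1a [y2 y2d ->]]|xU] := boolP (x \in limg (op X Ga) + limg (op X Gd))%VS.
    have [[u _ ->] [v _ ->]] := (memv_imgP y1a, memv_imgP y2d).
    by exists u, v.
  have [f [fx /subvP fU]] := separating_functional xU.
  have fa y : f (op X Ga y) = 0.
    by apply/eqP; rewrite -memv_ker fU // (subvP (addvSl _ _)) // memv_img ?memvf.
  have fd y : f (op X Gd y) = 0.
    by apply/eqP; rewrite -memv_ker fU // (subvP (addvSr _ _)) // memv_img ?memvf.
  (* A lift [g] of this [t] would have both middle coordinates of [g x] equal to zero, as [b] and
     [c] kill [x]; modulo [P2] this contradicts [f x != 0]. *)
  pose t : 'Hom(X, I13) := rank1 (f \o op X E2)%VF ((0, (1, 0), 0) : I13).
  have tE y : t y = (0, (f (op X E2 y), 0), 0).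
    rewrite rank1E comp_lfunE.
    by congr (_, (_, _), _); rewrite ?scaler0 ?[_ *: _]mulr1.
  have [|g [hg gt]] := L t.
    apply: hom_modP3 => i y; rewrite mem_limg_hull_P2 !tE op_I13 opM /=.
    by case: i; rewrite /= ?fa ?fd ?linear0 ?subrr ?addr0 ?eqxx.
  have := gt x; rewrite mem_limg_hull_P2 tE ex /=.
  have : g (op X Gb x) = 0 by rewrite bx linear0.
  have : g (op X Gc x) = 0 by rewrite cx linear0.
  rewrite !(hom_op _ _ hg) !op_I13; case: (g x) => [[s [u u']] r] /= [->] [->].
  by rewrite sub0r subr0 oppr_eq0 (negPf fx).
pose f := ((co42 k : 'Hom(I13, K)) \o t - ((co43 k : 'Hom(I13, K)) \o t))%VF.
have fE y : f y = (t y).1.2.1 - (t y).1.2.2.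
  by rewrite add_lfunE opp_lfunE !comp_lfunE co42E co43E.
have fop i y : f (op X i y) = if i is E2 then f y else 0.
  have := hom_mod_op i y ht; rewrite mem_limg_hull_P2 => /eqP /subr_exchange.
  by rewrite !fE op_I13 => ->; case: i; rewrite /= ?subrr.
pose B : 'Hom(X, dsum X X) := dsum_pair (op X Gb) (op X Gc).
have KB : (lker B <= lker f)%VS.
  apply/subvP => y; rewrite !memv_ker dsum_pairE => /eqP[by0 cy0].
  have [||| u [v euv]] := b (op X E2 y); rewrite ?opM //= ?by0 ?cy0 //.
  by have := fop E2 y; rewrite euv linearD /= !fop addr0 => <-.
pose h : 'Hom(dsum X X, K) := (f \o B^-1)%VF.
have hB y : h (op X Gb y, op X Gc y) = f y.
  by rewrite -(dsum_pairE (op X Gb)) comp_lfunE; apply: (eq_lkerB KB); apply: lker_invB.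
clearbody h.
(* The sign makes the difference of the middle coordinates equal to [h (b y, c y) = f y]. *)
exists (to_I13 (h \o @dsum_inl _ _ X X)%VF (- (h \o @dsum_inr _ _ X X))%VF).
split; first exact: to_I13_hom.
move=> y; rewrite mem_limg_hull_P2 to_I13E !opp_lfunE !comp_lfunE !dsum_inlE !dsum_inrE /=.
have -> : h (op X Gb y, 0) = (t y).1.2.1 - (t y).1.2.2 - h (0, op X Gc y).
  rewrite -fE -hB; apply/(canRL (addrK _)); rewrite -linearD /=; congr (h _).
  by apply: injective_projections; rewrite /= ?addr0 ?add0r.
by rewrite -[X in X - _ == _]addrA [X in X == _]addrC addKr addrC.
Qed.

(** The coordinates [y.2.1.1] and [y.1.2] identify the cokernel with [S1 (+) S3]. The homomorphism
    modulo [P13] is a pair of functionals, on [V1] vanishing on [im b] and on [V3] vanishing on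
    [im c]; it lifts when they factor through [a] and [d]. *)
Lemma lifts_hull_P13 X :
  lifts_mod X (limg (hull_P13 k)) <-> balanced1 X /\ balanced3 X.
Proof.
split=> [L|[b1 b3] t ht]; first split=> [x ex ax|x ex dx].
- have [/memv_imgP[u _ ->]|xU] := boolP (x \in limg (op X Gb)); first by exists u.
  have [f [fx /subvP fU]] := separating_functional xU.
  have fb y : f (op X Gb y) = 0 by apply/eqP; rewrite -memv_ker fU // memv_img ?memvf.
  pose t : 'Hom(X, dsum I2 I2) := rank1 (f \o op X E1)%VF ((0, (1, 0, 0)) : dsum I2 I2).
  have tE y : t y = (0, (f (op X E1 y), 0, 0)).
    rewrite rank1E comp_lfunE.
    by congr (_, _, _, (_, _, _)); rewrite ?scaler0 ?[_ *: _]mulr1.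
  have [|g [hg gt]] := L t.
    apply: hom_modP3 => i y; rewrite mem_limg_hull_P13 !tE op_dsum !op_I2 opM /=.
    by case: i; rewrite /= ?fb ?linear0 ?subrr ?addr0 ?eqxx.
  have := gt x; rewrite mem_limg_hull_P13 tE ex /=.
  have : g (op X Ga x) = 0 by rewrite ax linear0.
  rewrite (hom_op _ _ hg) op_dsum !op_I2.
  case: (g x) => [[[s u] r] [[s' u'] r']] /= [_ ->] /andP[_].
  by rewrite sub0r oppr_eq0 (negPf fx).
- have [/memv_imgP[u _ ->]|xU] := boolP (x \in limg (op X Gc)); first by exists u.
  have [f [fx /subvP fU]] := separating_functional xU.
  have fc y : f (op X Gc y) = 0 by apply/eqP; rewrite -memv_ker fU // memv_img ?memvf.
  pose t : 'Hom(X, dsum I2 I2) := rank1 (f \o op X E3)%VF (((0, 0, 1), 0) : dsum I2 I2).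
  have tE y : t y = ((0, 0, f (op X E3 y)), 0).
    rewrite rank1E comp_lfunE.
    by congr (_, _, _, (_, _, _)); rewrite ?scaler0 ?[_ *: _]mulr1.
  have [|g [hg gt]] := L t.
    apply: hom_modP3 => i y; rewrite mem_limg_hull_P13 !tE op_dsum !op_I2 opM /=.
    by case: i; rewrite /= ?fc ?linear0 ?subrr ?addr0 ?eqxx.
  have := gt x; rewrite mem_limg_hull_P13 tE ex /=.
  have : g (op X Gd x) = 0 by rewrite dx linear0.
  rewrite (hom_op _ _ hg) op_dsum !op_I2.
  case: (g x) => [[[s u] r] [[s' u'] r']] /= [-> _] /andP[].
  by rewrite sub0r oppr_eq0 (negPf fx).
pose f1 : 'Hom(X, K) := ((co31 k : 'Hom(I2, K)) \o @dsum_snd _ _ I2 I2 \o t)%VF.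
pose f3 : 'Hom(X, K) := ((co33 k : 'Hom(I2, K)) \o @dsum_fst _ _ I2 I2 \o t)%VF.
have f1E y : f1 y = (t y).2.1.1 by rewrite !comp_lfunE co31E (@dsum_sndE _ _ I2 I2).
have f3E y : f3 y = (t y).1.2 by rewrite !comp_lfunE co33E (@dsum_fstE _ _ I2 I2).
have fop i y : f1 (op X i y) = (if i is E1 then f1 y else 0) /\
               f3 (op X i y) = (if i is E3 then f3 y else 0).
  have := hom_mod_op i y ht; rewrite mem_limg_hull_P13 /= !subr_eq0 => /andP[/eqP e3 /eqP e1].
  by rewrite !f1E !f3E e1 e3 (op_dsum i (t y)) !op_I2; clear e1 e3; case: i.
have K1 : (lker (op X Ga) <= lker f1)%VS.
  apply/subvP => y; rewrite !memv_ker => /eqP ay.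
  have [||u eu] := b1 (op X E1 y); rewrite ?opM //=.
  by have [<- _] := fop E1 y; rewrite eu; have [-> _] := fop Gb u.
have K3 : (lker (op X Gd) <= lker f3)%VS.
  apply/subvP => y; rewrite !memv_ker => /eqP dy.
  have [||u eu] := b3 (op X E3 y); rewrite ?opM //=.
  by have [_ <-] := fop E3 y; rewrite eu; have [_ ->] := fop Gc u.
pose g1 := (f1 \o (op X Ga)^-1)%VF; pose g3 := (f3 \o (op X Gd)^-1)%VF.
have g1E y : g1 (op X Ga y) = f1 y.
  by rewrite comp_lfunE; apply: (eq_lkerB K1); apply: lker_invB.
have g3E y : g3 (op X Gd y) = f3 y.
  by rewrite comp_lfunE; apply: (eq_lkerB K3); apply: lker_invB.
exists (dsum_pair (to_I2 g3) (to_I2 g1)); split.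
  by apply: dsum_pair_hom; apply: to_I2_hom.
move=> y; rewrite mem_limg_hull_P13 dsum_pairE !to_I2E /= g1E g3E f1E f3E.
by rewrite !subrr eqxx.
Qed.

Lemma hull_P2_inj : injective (hull_P2 k).
Proof. by move=> [[s t] r] [[s' t'] r']; rewrite !hull_P2E /= => -[-> -> _ ->]. Qed.

Lemma hull_P13_inj : injective (hull_P13 k).
Proof.
by move=> [[s [t u]] r] [[s' [t' u']] r']; rewrite !hull_P13E /= => -[-> -> -> ->].
Qed.

Lemma Ext1_tilting_l X : Ext1_zero (tilting k) X <-> balanced X.
Proof.
(* The projective summands are covered by identities, whose zero kernels impose no condition. *)
have c : proj_epi (dsum_map (dsum_map (\1%VF : 'End(P2)) (\1%VF : 'End(P13)))
                            (dsum_map (cover_I2 k) (cover_I13 k))).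
  apply: cover_dsum; apply: cover_dsum.
  - by apply: cover_id; apply: P2_projective.
  - by apply: cover_id; apply: P13_projective.
  - exact: cover_I2P.
  - exact: cover_I13P.
apply: iff_trans (Ext1_zero_cover (@enough_projectives k) X c) _.
apply: iff_trans (ext_onto_dsum _ _ _) _.
have e1 := ext_onto_dsum (\1%VF : 'End(P2)) (\1%VF : 'End(P13)) X.
have e2 := ext_onto_dsum (cover_I2 k) (cover_I13 k) X.
have e3 := ext_onto_cover_I2 X; have e4 := ext_onto_cover_I13 X.
have i1 := @ext_onto_id _ _ P2 X; have i2 := @ext_onto_id _ _ P13 X.
by rewrite /balanced; split=> [[_ /e2[/e3 ? /e4[? ?]]]|[? ? ?]]; [split|split;
  [apply/e1|apply/e2; split; [apply/e3|apply/e4]]].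
Qed.

Lemma Ext1_tilting_r X : Ext1_zero X (tilting k) <-> balanced X.
Proof.
have [P [p cp]] := enough_projectives X; have [_ hp _] := cp.
apply: iff_trans (Ext1_zero_cover (@enough_projectives k) (tilting k) cp) _.
have sK := submod_lker hp.
have i1 := @I2_injective k _ _ sK; have i2 := @I13_injective k _ _ sK.
have hh2 : is_hom (hull_P2 k) by apply: to_I13_hom.
have hh13 : is_hom (hull_P13 k) by apply: dsum_pair_hom; apply: to_I2_hom.
have iII := injective_dsum (@I2_injective k) (@I2_injective k).
have l2 := ext_onto_lifts_mod cp hh2 hull_P2_inj (@I13_injective k).
have l13 := ext_onto_lifts_mod cp hh13 hull_P13_inj iII.
have r0 := ext_onto_dsum_r (lker p) (dsum P2 P13) (dsum I2 I13).
have r1 := ext_onto_dsum_r (lker p) P2 P13.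
have r2 := ext_onto_dsum_r (lker p) I2 I13.
have e2 := lifts_hull_P2 X; have e13 := lifts_hull_P13 X.
split=> [/r0[/r1[/l2/e2 ? /l13/e13[? ?]] _]|[? ? ?]]; first by split.
apply/r0; split; last by apply/r2.
by apply/r1; split; [apply/l2/e2|apply/l13/e13].
Qed.

End TiltingExtensions.

(** * Decomposing balanced modules *)

(** Projections onto [S :&: T], a complement of it in [S], one in [T], and a complement of [S + T].
    As [addv_pi1 S T] kills [T] and leaves a remainder in [T], removing both [pS] and [pT] from the
    part in [S + T] leaves a vector of both subspaces. *)
Lemma two_subspaces (k : fieldType) (V : vectType k) (S T : {vspace V}) :
  exists pI pS pT pC : 'End(V),
  [/\ forall x, x = pI x + pS x + pT x + pC x,
      forall x, [/\ pI x \in S, pI x \in T, pS x \in S & pT x \in T],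
      forall x, x \in S -> pT x = 0 /\ pC x = 0
    & forall x, x \in T -> pS x = 0 /\ pC x = 0].
Proof.
pose p := projv (S + T); pose pS := (addv_pi1 S T \o p)%VF.
pose pT := (addv_pi1 T S \o p)%VF.
have pE x : x \in (S + T)%VS -> p x = x by apply: projv_id.
have pi1_0 (U W : {vspace V}) x : x \in W -> addv_pi1 U W x = 0.
  move=> xW; have := addv_pi1_pi2 (subvP (addvSr U W) _ xW).
  by rewrite addv_pi2_id // => /(canRL (addrK _)) ->; rewrite subrr.
have pin x : p x \in (S + T)%VS by apply: memv_proj.
have SE x : pS x = addv_pi1 S T (p x) by rewrite comp_lfunE.
have TE x : pT x = addv_pi1 T S (p x) by rewrite comp_lfunE.
have pSin x : pS x \in S by rewrite SE memv_pi1.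
have pTin x : pT x \in T by rewrite TE memv_pi1.
have SinT x : p x - pS x \in T.
  by rewrite SE -{1}(addv_pi1_pi2 (pin x)) addrC addKr memv_pi2.
have TinS x : p x - pT x \in S.
  have h : p x \in (T + S)%VS by rewrite addvC.
  by rewrite TE -{1}(addv_pi1_pi2 h) addrC addKr memv_pi2.
pose pI : 'End(V) := p - pS - pT; pose pC : 'End(V) := \1%VF - p.
have IE x : pI x = p x - pS x - pT x by rewrite !lfun_simp.
have CE x : pC x = x - p x by rewrite !lfun_simp.
exists pI, pS, pT, pC; split=> [x|x|x xS|x xT].
- by rewrite IE CE (addrAC _ (- pT x)) !subrK addrC subrK.
- by rewrite IE; split=> //; [rewrite addrAC|]; rewrite memvB.
- have xST := subvP (addvSl S T) _ xS.
  by rewrite TE CE pE // pi1_0 // subrr.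
- have xST := subvP (addvSr S T) _ xT.
  by rewrite SE CE pE // pi1_0 // subrr.
Qed.

Section Decomposition.
Variable k : fieldType.
Local Notation A := (rad_square_zero k quiver3).
Local Notation K := (k^o).
Variable X : rmod A.
Local Notation op := (op X).

(** The pieces of [V2] correspond to the summands: [V20] consists of the tops of copies of [P2],
    [Za] and [Zd] of the socles of copies of [P1] and [P3], [Z] of the socles of copies of [I2], and
    [V2c] and [V2b] of the tops of copies of [I1] and [I3]. *)
Lemma balanced_in_add : balanced X -> in_add (tilting k) X.
Proof.
move=> [b1 b2 b3].
have [pI [pS [pT [pC [p_sum p_in pS0 pT0]]]]] := two_subspaces (lker (op Gb)) (lker (op Gc)).
have [rI [rS [rT [rC [r_sum r_in rS0 rT0]]]]] := two_subspaces (limg (op Ga)) (limg (op Gd)).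
(* The kernels of [op Gb] and [op Gc] are taken in all of [X] and contain [V1] and [V3]; [cut]
   confines the projections to [V2]. *)
pose cut (f : 'End(X)) := (op E2 \o f \o op E2)%VF.
have cutE f x : cut f x = op E2 (f (op E2 x)) by rewrite !comp_lfunE.
(* Projections of [V2] onto [V20], [V2b <= ker b], [V2c <= ker c] and
   [ker b :&: ker c = Z (+) Za (+) Zd], with [Z = im a :&: im d]. *)
pose q0 := cut pC; pose qb := cut pS; pose qc := cut pT; pose kap := cut pI.
pose qZ := (rI \o kap)%VF; pose qa := (rS \o kap)%VF; pose qd := (rT \o kap)%VF.
have qZE x : qZ x = rI (kap x) by rewrite [LHS]comp_lfunE.
have qaE x : qa x = rS (kap x) by rewrite [LHS]comp_lfunE.
have qdE x : qd x = rT (kap x) by rewrite [LHS]comp_lfunE.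
have q_sum x : op E2 x = kap x + qb x + qc x + q0 x.
  by rewrite !cutE -!linearD /= -p_sum !opM.
have bE2 x : op Gb (op E2 x) = op Gb x by rewrite opM.
have cE2 x : op Gc (op E2 x) = op Gc x by rewrite opM.
have qE2 f x : cut f (op E2 x) = cut f x by rewrite !cutE opM.
have bker x : (x \in lker (op Gb)) = (op Gb x == 0) by rewrite memv_ker.
have cker x : (x \in lker (op Gc)) = (op Gc x == 0) by rewrite memv_ker.
have b_qb x : op Gb (qb x) = 0.
  by rewrite cutE bE2; apply/eqP; rewrite -bker; case: (p_in (op E2 x)).
have c_qc x : op Gc (qc x) = 0.
  by rewrite cutE cE2; apply/eqP; rewrite -cker; case: (p_in (op E2 x)).
have b_kap x : op Gb (kap x) = 0.
  by rewrite cutE bE2; apply/eqP; rewrite -bker; case: (p_in (op E2 x)).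
have c_kap x : op Gc (kap x) = 0.
  by rewrite cutE cE2; apply/eqP; rewrite -cker; case: (p_in (op E2 x)).
have ker_b x : op Gb x = 0 -> qc x = 0 /\ q0 x = 0.
  move=> bx; have [|e1 e2] := pS0 (op E2 x); first by rewrite bker bE2 bx.
  by rewrite !cutE e1 e2 linear0.
have ker_c x : op Gc x = 0 -> qb x = 0 /\ q0 x = 0.
  move=> cx; have [|e1 e2] := pT0 (op E2 x); first by rewrite cker cE2 cx.
  by rewrite !cutE e1 e2 linear0.
(* Here [b2] enters; it makes the leftover projection [rC] vanish on the values of [kap]. *)
have kap_in x : kap x \in (limg (op Ga) + limg (op Gd))%VS.
  have [|||y [z ->]] := b2 (kap x) => //; first by rewrite cutE opM.
  by rewrite memv_add ?memv_img ?memvf.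
have kap_sum x : kap x = qZ x + qa x + qd x.
  rewrite {1}(r_sum (kap x)) qZE qaE qdE; have /memv_addP[u uS [v vT ->]] := kap_in x.
  by rewrite [rC _]linearD /=; have [_ ->] := rS0 u uS; have [_ ->] := rT0 v vT; rewrite !addr0.
have kap_id x : op Gb x = 0 -> op Gc x = 0 -> kap x = op E2 x.
  move=> bx cx; rewrite q_sum; have [-> ->] := ker_b x bx; have [-> _] := ker_c x cx.
  by rewrite !addr0.
have kap_a x : kap (op Ga x) = op Ga x by rewrite kap_id ?opM.
have kap_d x : kap (op Gd x) = op Gd x by rewrite kap_id ?opM.
have qa_d x : qa (op Gd x) = 0.
  by rewrite qaE kap_d; case: (rT0 (op Gd x)) => //; rewrite memv_img ?memvf.
have qd_a x : qd (op Ga x) = 0.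
  by rewrite qdE kap_a; case: (rS0 (op Ga x)) => //; rewrite memv_img ?memvf.
(* [s1], [s3], [t1], [t3] are partial inverses of [a], [d], [b], [c]. *)
pose s1 := (op E1 \o (op Ga)^-1)%VF; pose s3 := (op E3 \o (op Gd)^-1)%VF.
have s1K y : y \in limg (op Ga) -> op Ga (s1 y) = y.
  by move=> yS; rewrite comp_lfunE opM /= limg_lfunVK.
have s3K y : y \in limg (op Gd) -> op Gd (s3 y) = y.
  by move=> yS; rewrite comp_lfunE opM /= limg_lfunVK.
have a_sZ x : op Ga (s1 (qZ x)) = qZ x.
  by rewrite s1K // qZE; case: (r_in (kap x)).
have a_sa x : op Ga (s1 (qa x)) = qa x.
  by rewrite s1K // qaE; case: (r_in (kap x)).
have d_sZ x : op Gd (s3 (qZ x)) = qZ x.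
  by rewrite s3K // qZE; case: (r_in (kap x)).
have d_sd x : op Gd (s3 (qd x)) = qd x.
  by rewrite s3K // qdE; case: (r_in (kap x)).
pose t1 := ((op Gb)^-1 \o (\1 - (s1 \o op Ga)))%VF.
pose t3 := ((op Gc)^-1 \o (\1 - (s3 \o op Gd)))%VF.
have t1E x : t1 x = ((op Gb)^-1)%VF (x - s1 (op Ga x)) by rewrite !lfun_simp.
have t3E x : t3 x = ((op Gc)^-1)%VF (x - s3 (op Gd x)) by rewrite !lfun_simp.
have t1b x : t1 (op Gb x) - x \in lker (op Gb).
  by rewrite t1E opM /= linear0 subr0 lker_invB.
have t3c x : t3 (op Gc x) - x \in lker (op Gc).
  by rewrite t3E opM /= linear0 subr0 lker_invB.
(* [t1] inverts [b] only up to [ker b], which [qc] and [q0] kill; likewise [t3] inverts [c] up to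
   [ker c], which [qb] and [q0] kill. *)
have qc_t1 x : qc (t1 (op Gb x)) = qc x.
  apply/eqP; rewrite -subr_eq0 -linearB /=; apply/eqP.
  by case: (ker_b (t1 (op Gb x) - x)) => //; apply/eqP; rewrite -bker.
have q0_t1 x : q0 (t1 (op Gb x)) = q0 x.
  apply/eqP; rewrite -subr_eq0 -linearB /=; apply/eqP.
  by case: (ker_b (t1 (op Gb x) - x)) => //; apply/eqP; rewrite -bker.
have qb_t3 x : qb (t3 (op Gc x)) = qb x.
  apply/eqP; rewrite -subr_eq0 -linearB /=; apply/eqP.
  by case: (ker_c (t3 (op Gc x) - x)) => //; apply/eqP; rewrite -cker.
have q0_t3 x : q0 (t3 (op Gc x)) = q0 x.
  apply/eqP; rewrite -subr_eq0 -linearB /=; apply/eqP.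
  by case: (ker_c (t3 (op Gc x) - x)) => //; apply/eqP; rewrite -cker.
(* The right-hand side is the component in [ker a], and [b1] provides a preimage under [b]. *)
have b_t1 x : op Gb (t1 (op E1 x)) = op E1 x - s1 (op Ga x).
  have aE : op Ga (op E1 x) = op Ga x by rewrite opM.
  rewrite t1E aE limg_lfunVK //.
  have [||y ->] := b1 (op E1 x - s1 (op Ga x)); last by rewrite memv_img ?memvf.
    by rewrite linearB /= opM comp_lfunE opM.
  by rewrite linearB /= aE s1K ?subrr // memv_img ?memvf.
have c_t3 x : op Gc (t3 (op E3 x)) = op E3 x - s3 (op Gd x).
  have dE : op Gd (op E3 x) = op Gd x by rewrite opM.
  rewrite t3E dE limg_lfunVK //.
  have [||y ->] := b3 (op E3 x - s3 (op Gd x)); last by rewrite memv_img ?memvf.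
    by rewrite linearB /= opM comp_lfunE opM.
  by rewrite linearB /= dE s3K ?subrr // memv_img ?memvf.
have E2q f x : op E2 (cut f x) = cut f x by rewrite cutE opM.
have E2q0 x : op E2 (q0 x) = q0 x by exact: E2q.
have E2qb x : op E2 (qb x) = qb x by exact: E2q.
have E2qc x : op E2 (qc x) = qc x by exact: E2q.
have q0E2 x : q0 (op E2 x) = q0 x by exact: qE2.
have kapE2 x : kap (op E2 x) = kap x by exact: qE2.
have E1s1 x : op E1 (s1 x) = s1 x by rewrite [s1 x]comp_lfunE opM.
have E3s3 x : op E3 (s3 x) = s3 x by rewrite [s3 x]comp_lfunE opM.
have q0_a x : q0 (op Ga x) = 0 by case: (ker_b (op Ga x)); rewrite ?opM.
have q0_d x : q0 (op Gd x) = 0 by case: (ker_b (op Gd x)); rewrite ?opM.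
clear qZE qaE qdE t1E t3E qE2 E2q; clearbody t1 t3 s1 s3 qZ qa qd kap q0 qb qc.
set n := \dim (fullv : {vspace X}); pose b := vbasis (fullv : {vspace X}).
(* Dual bases: any endomorphism is the sum of the rank one maps given by [phi i] and the image of
   the [i]-th basis vector. Each [u i] carries [phi i] into the tilting module and each [v i]
   carries the basis vector out of it. *)
pose phi (i : 'I_n) := coord_fun b i.
have phi_sum (f : 'End(X)) y : \sum_i phi i y *: f b`_i = f y.
  rewrite [in RHS](coord_vbasis (memvf y)) linear_sum; apply: eq_bigr => i _.
  by rewrite linearZ /phi coord_funE.
have phi_sum2 (f g : 'End(X)) y : \sum_i phi i y *: f (g b`_i) = f (g y).
  rewrite -[RHS]comp_lfunE -phi_sum.
  by apply: eq_bigr => i _; rewrite comp_lfunE.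
have phi_sum3 (f g h : 'End(X)) y : \sum_i phi i y *: f (g (h b`_i)) = f (g (h y)).
  rewrite -[g (h y)]comp_lfunE -phi_sum2.
  by apply: eq_bigr => i _; rewrite comp_lfunE.
pose u2 i := to_P2 (phi i \o q0 \o t1)%VF (phi i \o q0)%VF (phi i \o q0 \o t3)%VF.
pose u13 i := to_P13 (phi i \o qa)%VF (phi i \o qd)%VF.
pose w2 i := to_I2 (phi i).
pose w13 i := to_I13 (phi i \o t1)%VF (phi i \o t3)%VF.
pose u i := dsum_pair (dsum_pair (u2 i) (u13 i)) (dsum_pair (w2 i) (w13 i)).
pose v (i : 'I_n) := dsum_copair
  (dsum_copair (from_P2 b`_i) (from_P13 (s1 b`_i) (s3 b`_i)))
  (dsum_copair (from_I2 (s1 (qZ b`_i)) (s3 (qZ b`_i))) (from_I13 (qc b`_i) (qb b`_i))).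
apply: (in_add_split (u := u) (v := v)) => [i|i|x].
- apply: dsum_pair_hom; apply: dsum_pair_hom.
  + apply: to_P2_hom => x; rewrite !comp_lfunE.
    * by rewrite q0_t1 q0E2.
    * by rewrite q0_t3 q0E2.
    * by rewrite q0_a linear0.
    * by rewrite q0_d linear0.
  + by apply: to_P13_hom => x; rewrite comp_lfunE (qa_d, qd_a) linear0.
  + exact: to_I2_hom.
  + exact: to_I13_hom.
- apply: dsum_copair_hom; apply: dsum_copair_hom.
  + exact: from_P2_hom.
  + exact: from_P13_hom.
  + by apply: from_I2_hom; rewrite a_sZ d_sZ.
  + exact: from_I13_hom.
have S1 : \sum_(i < n) from_P2 b`_i (u2 i x) =
    op Gb (q0 (t1 (op E1 x))) + q0 x + op Gc (q0 (t3 (op E3 x))).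
  under eq_bigr do rewrite from_P2E to_P2E !comp_lfunE /=.
  by rewrite !big_split /= !phi_sum E2q0 q0E2.
have S2 : \sum_(i < n) from_P13 (s1 b`_i) (s3 b`_i) (u13 i x) =
    s1 (qa (op Ga x)) + qa (op E2 x) + qd (op E2 x) + s3 (qd (op Gd x)).
  under eq_bigr do rewrite from_P13E to_P13E !comp_lfunE /=.
  by rewrite !big_split /= !phi_sum2 E1s1 E3s3 a_sa d_sd.
have S3 : \sum_(i < n) from_I2 (s1 (qZ b`_i)) (s3 (qZ b`_i)) (w2 i x) =
    s1 (qZ (op Ga x)) + qZ (op E2 x) + s3 (qZ (op Gd x)).
  under eq_bigr do rewrite from_I2E to_I2E /=.
  by rewrite !big_split /= !phi_sum3 E1s1 E3s3 a_sZ.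
have S4 : \sum_(i < n) from_I13 (qc b`_i) (qb b`_i) (w13 i x) =
    op Gb (qc (t1 (op E1 x))) + qc x + qb x + op Gc (qb (t3 (op E3 x))).
  under eq_bigr do rewrite from_I13E to_I13E !comp_lfunE /=.
  by rewrite !big_split /= !phi_sum2 E2qc E2qb qc_t1 qb_t3.
(* At vertex 1 the [P2] and [I13] parts add up to the component in [ker a], and the [P13] and [I2]
   parts ([Ta]) to the complementary one; [T3] and [Td] do the same at vertex 3. *)
have T1 : op Gb (q0 (t1 (op E1 x))) + op Gb (qc (t1 (op E1 x))) = op E1 x - s1 (op Ga x).
  by rewrite -b_t1 -[RHS]bE2 q_sum !linearD /= b_kap b_qb !add0r addrC.
have T3 : op Gc (q0 (t3 (op E3 x))) + op Gc (qb (t3 (op E3 x))) = op E3 x - s3 (op Gd x).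
  by rewrite -c_t3 -[RHS]cE2 q_sum !linearD /= c_kap c_qc !(add0r, addr0) addrC.
have Ta : s1 (qa (op Ga x)) + s1 (qZ (op Ga x)) = s1 (op Ga x).
  by rewrite -{3}[op Ga x]kap_a kap_sum qd_a addr0 linearD addrC.
have Td : s3 (qd (op Gd x)) + s3 (qZ (op Gd x)) = s3 (op Gd x).
  by rewrite -{3}[op Gd x]kap_d kap_sum qa_d addr0 linearD addrC.
have vu (i : 'I_n) : v i (u i x) =
    (from_P2 b`_i (u2 i x) + from_P13 (s1 b`_i) (s3 b`_i) (u13 i x)) +
    (from_I2 (s1 (qZ b`_i)) (s3 (qZ b`_i)) (w2 i x) +
     from_I13 (qc b`_i) (qb b`_i) (w13 i x)).
  by rewrite /v /u !dsum_copairE !dsum_pairE.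
rewrite (eq_bigr _ (fun i _ => vu i)) !big_split /=.
rewrite S1 S2 S3 S4.
(* Sorts the fourteen terms by vertex: [T1] and [Ta], then the six pieces of [V2], then [T3] and
   [Td]. *)
rewrite (AC ((3*4)*(3*4)) ((1*11)*(4*8)*((9*5)*6*13*12*2)*((3*14)*(7*10)))).
by rewrite /= T1 Ta subrK -kap_sum kapE2 -q_sum T3 Td subrK -op_sum.
Qed.

End Decomposition.

(** * The minimal resolution of the simple at the middle vertex *)

Section Resolution.
Variable k : fieldType.
Local Notation A := (rad_square_zero k quiver3).
Local Notation P2 := (P2 k).
Local Notation P13 := (P13 k).
Implicit Types M N X Y : rmod A.

Definition simple2 : rmod A := simple_at k (inord 1 : vertex quiver3).

Lemma op_simple2 i (x : simple2) : op simple2 i x = if i is E2 then x else 0.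
Proof.
rewrite /op ract_rsz_mod /simple_op; case: eqP => [|ne].
  by move/(can_inj (gen3_idxK) (x2 := E2)) => ->; rewrite id_lfunE.
by rewrite zero_lfunE; case: i ne => // -[].
Qed.

Definition simple2_aug : 'Hom(P2, simple2) := co32 k.

Lemma simple2_augE x : simple2_aug x = x.1.2.
Proof. exact: co32E. Qed.

Lemma simple2_aug_hom : is_hom simple2_aug.
Proof.
by apply: is_homP3 => i x; rewrite !simple2_augE op_simple2 op_P2; case: i.
Qed.

Definition res_step1 : 'Hom(P13, P2) := from_P13 ((1, 0, 0) : P2) ((0, 0, 1) : P2).

Lemma res_step1E x : res_step1 x = (x.1.1, 0, x.2).
Proof.
rewrite from_P13E !op_P2 /= !scaler0 !addr0.
by congr (_, _, _); rewrite /= ?scaler0 ?addr0 ?add0r ?[_ *: _]mulr1.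
Qed.

Definition res_step2 : 'Hom(dsum P2 P2, P13) :=
  dsum_copair (from_P2 ((0, (1, 0), 0) : P13)) (from_P2 ((0, (0, 1), 0) : P13)).

Lemma res_step2E x : res_step2 x = (0, (x.1.1.2, x.2.1.2), 0).
Proof.
rewrite dsum_copairE !from_P2E !op_P13 /= !scaler0 !addr0 !add0r.
by congr (_, (_, _), _); rewrite /= ?scaler0 ?addr0 ?add0r ?[_ *: _]mulr1.
Qed.

(** The first syzygy of [S2] is [rad P2 = S1 (+) S3] and the second is [rad P13 = S2 (+) S2], so
    every two steps the resolution restarts in two copies. *)
Fixpoint res2_obj (n : nat) : rmod A :=
  match n with
  | 0 => P2
  | 1 => P13
  | m.+2 => dsum (res2_obj m) (res2_obj m)
  end.

Fixpoint res2_diff (n : nat) : 'Hom(res2_obj n.+1, res2_obj n) :=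
  match n return 'Hom(res2_obj n.+1, res2_obj n) with
  | 0 => res_step1
  | 1 => res_step2
  | m.+2 => dsum_map (res2_diff m) (res2_diff m)
  end.

Lemma nat_ind2 (P : nat -> Prop) :
  P 0%N -> P 1%N -> (forall n, P n -> P n.+2) -> forall n, P n.
Proof.
move=> P0 P1 PS n; suff: P n /\ P n.+1 by case.
by elim: n => [|n [Pn Pn1]]; split=> //; apply: PS.
Qed.

Lemma res2_diff_hom n : is_hom (res2_diff n).
Proof.
elim/nat_ind2: n => [||n IH] /=; last exact: dsum_map_hom.
  exact: from_P13_hom.
by apply: dsum_copair_hom; apply: from_P2_hom.
Qed.

Lemma res2_projective n : projective (res2_obj n).
Proof.
elim/nat_ind2: n => [||n IH] /=; last exact: projective_dsum.
  exact: P2_projective.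
exact: P13_projective.
Qed.

Lemma simple2_aug_onto : limg simple2_aug = fullv.
Proof. by apply: limg_fullP => t; exists (0, t, 0); rewrite simple2_augE. Qed.

Lemma mem_lker_aug x : (x \in lker simple2_aug) = (x.1.2 == 0).
Proof. by rewrite memv_ker simple2_augE. Qed.

Lemma mem_lker_step1 x : (x \in lker res_step1) = (x.1.1 == 0) && (x.2 == 0).
Proof.
rewrite memv_ker res_step1E; apply/eqP/andP => [[-> ->]|[/eqP -> /eqP ->]] //.
Qed.

Lemma mem_lker_step2 x : (x \in lker res_step2) = (x.1.1.2 == 0) && (x.2.1.2 == 0).
Proof.
rewrite memv_ker res_step2E; apply/eqP/andP => [[-> ->]|[/eqP -> /eqP ->]] //.
Qed.

Lemma res2_exact0 : limg (res2_diff 0) = lker simple2_aug.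
Proof.
apply/vspaceP => x; rewrite mem_lker_aug; apply/idP/eqP => [/memv_imgP[y _ ->]|].
  by rewrite res_step1E.
case: x => [[s t] r] /= ->; have -> : (s, 0, r) = res_step1 (s, (0, 0), r).
  by rewrite res_step1E.
by rewrite memv_img ?memvf.
Qed.

(** Two base cases are needed because [res2_diff] becomes diagonal only from index 2 on. In the case
    [n = 1], the kernel of [res_step2] is that of two copies of [simple2_aug], so [res2_exact0]
    applies. *)
Lemma res2_exact n : limg (res2_diff n.+1) = lker (res2_diff n).
Proof.
elim/nat_ind2: n => [||n IH]; apply/vspaceP => x.
- rewrite mem_lker_step1; apply/idP/andP => [/memv_imgP[y _ ->]|].
    by rewrite res_step2E !eqxx.
  case: x => [[s [t t']] r] /= [/eqP -> /eqP ->].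
  have -> : (0, (t, t'), 0) = res_step2 ((0, t, 0), (0, t', 0)) by rewrite res_step2E.
  by rewrite memv_img ?memvf.
- rewrite mem_lker_step2.
  have -> : (x \in limg (res2_diff 2)) = _ := mem_limg_dsum_map res_step1 res_step1 x.
  have E y : (y \in limg res_step1) = (y.1.2 == 0).
    by rewrite -mem_lker_aug -res2_exact0.
  by rewrite !E.
have -> : (x \in limg (res2_diff n.+3)) = _ :=
  mem_limg_dsum_map (res2_diff n.+1) (res2_diff n.+1) x.
by rewrite mem_lker_dsum_map IH.
Qed.

Definition simple2_resolution : proj_resolution simple2 :=
  ProjResolution res2_diff_hom simple2_aug_hom res2_projective simple2_aug_onto
    res2_exact0 res2_exact.

(** Membership in [M J], the radical of [M]. *)
Definition in_radical M (x : M) : Prop := exists y1 y2 y3 y4,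
  x = op M Ga y1 + op M Gb y2 + op M Gc y3 + op M Gd y4.

(* Nakayama: for [U + K = M] with [K] in the radical, [M] and [U] have the same
   radical, as the radical squares to zero. *)
Lemma superfluous_radical M (U : {vspace M}) :
  (forall x, x \in U -> in_radical x) -> superfluous U.
Proof.
move=> hU W sW eW.
have sub i y : (i = Ga \/ i = Gb) \/ (i = Gc \/ i = Gd) -> op M i y \in W.
  move=> hi; have /memv_addP[w wW [u uU ->]] : y \in (W + U)%VS by rewrite eW memvf.
  rewrite linearD /= [X in _ + X](_ : _ = 0) ?addr0; first exact: (submodP W).1.
  have [y1 [y2 [y3 [y4 ->]]]] := hU u uU.
  by case: hi => -[] ->; rewrite !linearD /= !opM /= !addr0.
suff UW : (U <= W)%VS by rewrite -eW; apply/esym/addv_idPl.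
apply/subvP => u /hU[y1 [y2 [y3 [y4 ->]]]].
by rewrite !memvD ?sub; auto.
Qed.

Lemma in_radical_dsum M N (x : dsum M N) :
  in_radical x.1 -> in_radical x.2 -> in_radical x.
Proof.
case: x => x x' [/= y1 [y2 [y3 [y4 ->]]]] [z1 [z2 [z3 [z4 ->]]]].
by exists (y1, z1), (y2, z2), (y3, z3), (y4, z4); rewrite !op_dsum.
Qed.

Lemma in_radical_P2 (x : P2) : x.1.2 = 0 -> in_radical x.
Proof.
case: x => [[s t] r] /= ->; exists 0, (0, s, 0), (0, r, 0), 0.
by rewrite !op_P2 /=; congr (_, _, _); rewrite /= ?addr0 ?add0r.
Qed.

Lemma in_radical_P13 (x : P13) : x.1.1 = 0 -> x.2 = 0 -> in_radical x.
Proof.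
case: x => [[s [t t']] r] /= -> ->; exists (t, 0, 0), 0, 0, (0, 0, t').
by rewrite !op_P13 /=; congr (_, (_, _), _); rewrite /= ?addr0 ?add0r.
Qed.

Lemma res2_radical n x : x \in lker (res2_diff n) -> in_radical x.
Proof.
elim/nat_ind2: n x => [||n IH] x.
- by rewrite mem_lker_step1 => /andP[/eqP ? /eqP ?]; apply: in_radical_P13.
- rewrite mem_lker_step2 => /andP[/eqP ? /eqP ?].
  by apply: in_radical_dsum; apply: in_radical_P2.
by rewrite mem_lker_dsum_map => /andP[/IH ? /IH ?]; apply: in_radical_dsum.
Qed.

Lemma simple2_resolution_minimal : minimal_resolution simple2_resolution.
Proof.
split=> [|n]; apply: superfluous_radical => x; last exact: res2_radical.
by rewrite mem_lker_aug => /eqP; apply: in_radical_P2.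
Qed.

Lemma res2_dim m : (2 ^ m <= \dim (fullv : {vspace res2_obj m.*2}))%N.
Proof.
elim: m => [|m IH]; first by rewrite dimvf.
rewrite doubleS dimvf /= expnS mul2n -addnn.
have -> : dim (res2_obj m.*2 * res2_obj m.*2)%type =
  (\dim (fullv : {vspace res2_obj m.*2}) + \dim (fullv : {vspace res2_obj m.*2}))%N.
  by rewrite !dimvf.
exact: leq_add.
Qed.

End Resolution.

(** With [m = (b + 1) t] one has [c (2 m)^b = C t^b], where [C = c (2 (b + 1))^b]. For [t > C] this
    is less than [t^(b + 1)], hence less than [(2^t)^(b + 1) = 2^m]. *)
Lemma exp_dominates_poly (R : realType) (c : R) b : 0 < c ->
  exists m, (0 < m)%N /\ c * (m.*2)%:R ^+ b < (2 ^ m)%:R.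
Proof.
move=> c0; pose C := c * (b.+1.*2)%:R ^+ b; pose t := Num.bound C.
have C0 : 0 < C by rewrite mulr_gt0 // exprn_gt0 // ltr0n.
have Ct : C < t%:R by apply: archi_boundP; apply: ltW.
have t0 : (0 < t)%N by rewrite -(ltr0n R); apply: lt_trans Ct.
exists (b.+1 * t)%N; split; first by rewrite muln_gt0.
rewrite doubleMl natrM exprMn mulrA -/C expnM.
apply: (@lt_le_trans _ _ (t%:R ^+ b.+1)).
  by rewrite exprS ltr_pM2r // exprn_gt0 // ltr0n.
rewrite -natrX ler_nat -expnM mulnC expnM leq_exp2r //.
by apply/ltnW/ltn_expl.
Qed.

Lemma simple2_infinite_complexity (R : realType) (k : fieldType) :
  infinite_complexity R (simple2 k).
Proof.
exists (simple2_resolution k); split; first exact: simple2_resolution_minimal.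
move=> b [c [c0 bound]]; have [m [m0 lt]] := exp_dominates_poly b c0.
have n0 : (0 < m.*2)%N by rewrite double_gt0.
suff : (2 ^ m)%:R < (2 ^ m)%:R :> R by rewrite ltxx.
apply: le_lt_trans lt; apply: le_trans (le_trans _ (bound m.*2 n0)) _.
  by rewrite ler_nat; apply: res2_dim.
(* The exponent [b - 1] is weakened to [b]; for [b = 0] it is [-1], and the inverse of a positive
   integer is at most 1. *)
rewrite ler_pM2l //; case: b {bound} => [|b].
  by rewrite sub0r exprN1 expr0 invf_le1 ?ler1n // ltr0n.
have -> : b.+1%:Z - 1 = b%:Z by rewrite -addn1 PoszD addrK.
by rewrite -exprnP exprS ler_peMl ?exprn_ge0 ?ler0n ?ler1n.
Qed.

(** Commuting with an arrow equates the coefficients at its two ends, so by connectedness of the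
    quiver all vertex coefficients equal one [l] with [l l = l]. Idempotence gives [x = 2 l x] for
    each arrow coefficient [x], hence [x = 0] both for [l = 0] and for [l = 1], in any
    characteristic. *)
Lemma central_idempotent_trivial (k : fieldType)
    (z : rad_square_zero k quiver3) :
  (forall x, z * x = x * z) -> z * z = z -> z = 0 \/ z = 1.
Proof.
move=> zC zz; pose co i := rsz_coef i z.
have arr (a : arrow quiver3) : co (inl (source a)) = co (inl (target a)).
  pose x := rsz_gen k (inr a : vertex quiver3 + arrow quiver3).
  have := etrans (esym (rsz_coef_arrowM a z x))
            (etrans (congr1 (rsz_coef (inr a)) (zC x)) (rsz_coef_arrowM a x z)).
  rewrite !rsz_coef_gen eqxx -/(co _) -/(co _).
  by rewrite !(mulr0, mul0r, mulr1, mul1r, addr0, add0r).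
have src i : (i < 4)%N -> source (inord i : arrow quiver3) = nth ord0 [:: inord 0; inord 1; inord 1; inord 2] i.
  by move=> hi; rewrite /= (tnth_nth ord0) /= inordK.
have trg i : (i < 4)%N -> target (inord i : arrow quiver3) = nth ord0 [:: inord 1; inord 0; inord 2; inord 1] i.
  by move=> hi; rewrite /= (tnth_nth ord0) /= inordK.
have e01 := arr (inord 0); rewrite src // trg // /= in e01.
have e12 := arr (inord 2); rewrite src // trg // /= in e12.
set l := co (inl (inord 1)) in e01 e12.
have vl (v : vertex quiver3) : co (inl v) = l.
  case: (idx_gen3 (inl v)) (idx_gen3K (inl v)) => // -[<-] //.
have ll : l * l = l.
  rewrite -(vl (inord 0)).
  exact: etrans (esym (rsz_coef_vertexM _ z z)) (congr1 (rsz_coef _) zz).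
have aE a : co (inr a) = l * co (inr a) + co (inr a) * l.
  rewrite -{1}(vl (source a)) -(vl (target a)).
  exact: etrans (congr1 (rsz_coef _) (esym zz)) (rsz_coef_arrowM a z z).
have [l0|l0] := eqVneq l 0.
  left; apply: rsz_coef_inj => -[v|a]; rewrite linear0.
    by rewrite -l0; apply: vl.
  by have := aE a; rewrite l0 mul0r mulr0 addr0.
have l1 : l = 1 by apply: (mulfI l0); rewrite ll mulr1.
right; apply: rsz_coef_inj => -[v|a].
  by rewrite rsz_coef_vertex1 -l1; apply: vl.
rewrite rsz_coef_arrow1; have /eqP := aE a.
by rewrite l1 mul1r mulr1 -subr_eq0 opprD addrA subrr sub0r oppr_eq0 => /eqP.
Qed.

(** A product decomposition would make the preimage of [(1, 0)] a central idempotent; were it 0 or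
    1, one of the two factors would be the zero ring. *)
Lemma rsz_quiver3_connected (k : fieldType) :
  connected_algebra (rad_square_zero k quiver3).
Proof.
move=> [B [C [f [g fK gK]]]]; pose z := g (1, 0).
have fz : f z = (1, 0) by apply: gK.
have fM u v : f (u * v) = f u * f v := rmorphM f u v.
have zC x : z * x = x * z.
  apply: (can_inj fK); refine (etrans (fM z x) (etrans _ (esym (fM x z)))).
  rewrite fz; case: (f x) => u v.
  by congr (_, _); rewrite /= ?mul1r ?mulr1 ?mul0r ?mulr0.
have zz : z * z = z.
  apply: (can_inj fK); refine (etrans (fM z z) _).
  by rewrite fz; congr (_, _); rewrite /= ?mul1r ?mul0r.
have [z0|z1] := central_idempotent_trivial zC zz.
  case/eqP: (oner_neq0 B); move: fz; rewrite z0 rmorph0.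
  by move/(congr1 fst)/esym.
case/eqP: (oner_neq0 C); move: fz; rewrite z1 rmorph1.
by move/(congr1 snd).
Qed.

Theorem theorem1p4 (R : realType) (k : fieldType) :
  let A := rad_square_zero k quiver3 in
  [/\ finite_dimensional A,
      connected_algebra A,
      exists M : rmod A, cluster_tilting2 M
    & exists S : rmod A, simple_module S /\ infinite_complexity R S].
Proof.
split.
- exact: rsz_finite_dimensional.
- exact: rsz_quiver3_connected.
- exists (tilting k) => X.
  have h : in_add (tilting k) X <-> balanced X.
    by split; [apply: in_add_balanced|apply: balanced_in_add].
  split; first exact: iff_trans h (iff_sym (Ext1_tilting_l X)).
  exact: iff_trans h (iff_sym (Ext1_tilting_r X)).
exists (simple2 k); split; first exact: simple_at_simple.
exact: simple2_infinite_complexity.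
Qed.
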